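(* Suppose that $(M,\mathbf m)$ is a metric projective structure with Weyl nullity almost everywhere and $B$ non-constant almost everywhere, where $B=B^g$ is the (smooth) function determined by a metric $g\in\mathbf m$. Let $\sigma^{ab}\in\Gamma(S^2TM(-2))$ be a solution of the metrisability equation $\operatorname{trace-free}(\nabla_a\sigma^{bc})=0$. Then, locally, $$\sigma^a{}_b=\nu\,\delta^a_b+\epsilon\,B^aB_b$$ for suitable densities $\nu$ and $\epsilon$, where $B_a:=\nabla_aB$, $\nabla$ is the Levi-Civita connection of $g$, and indices are raised and lowered using $g$.
   Context: Manifolds are smooth, connected and of dimension $n\ge2$; metrics are pseudo-Riemannian of arbitrary signature; indices are abstract. A statement holds almost everywhere if it is true on an open dense set. Two metrics are projectively equivalent if they have the same geodesics up to reparametrisation; a metric projective structure $\mathbf m$ on $M$ is an equivalence class of projectively equivalent metrics. For the Levi-Civita connection $\nabla$ of $g$: $[\nabla_\ell,\nabla_k]v^j=R^j{}_{i\ell k}v^i$, $R_{jk}=R^a{}_{jak}$, $\mathsf P_{jk}=\frac1{n-1}R_{jk}$, $\mathsf P^i{}_j=g^{ik}\mathsf P_{kj}$. The projective Weyl tensor $W^i{}_{jk\ell}=R^i{}_{jk\ell}+\delta^i_\ell\mathsf P_{jk}-\delta^i_k\mathsf P_{j\ell}$ is the same for all $g\in\mathbf m$. There is Weyl nullity at $x$ if there is $0\ne v\in T_xM$ with $W^i{}_{jk\ell}v^j=0$ at $x$. Where there is Weyl nullity, each $g\in\mathbf m$ determines $B=B^g$ by $\mathsf P^i{}_jv^j=Bv^i$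 for all $v$ in the nullity (the value is independent of $v$). $\mathcal E(1)$ is the positive $(2n+2)$-nd root of the oriented line bundle $(\Lambda^nTM)^2$, $\mathcal E(w)$ denotes its real powers, and $\mathcal B(w)=\mathcal B\otimes\mathcal E(w)$ for any bundle $\mathcal B$; densities are sections of the bundles $\mathcal E(w)$. The metrisability equation is equivalent to the existence of $\mu^b$ with $\nabla_a\sigma^{bc}+\delta^b_a\mu^c+\delta^c_a\mu^b=0$.
   Formalization: Dimension n≥3 is assumed (for n=2 the claim fails, e.g. g=(2+x+y)(dx²+dy²), where B is the Gauss curvature), and ''locally'' means near almost every point, namely near every point where B_a≠0, since ε need not extend to zeros of B_a. *)

(* Defs.v *)
From mathcomp Require Import all_boot all_order all_algebra.
From mathcomp Require Import all_classical all_reals all_analysis.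

Set Implicit Arguments.
Unset Strict Implicit.
Unset Printing Implicit Defensive.

Import Order.TTheory GRing.Theory Num.Theory.
Import numFieldNormedType.Exports.

Local Open Scope classical_set_scope.
Local Open Scope ring_scope.

(* Tensor fields are families of component functions, one for each chart of a
   fixed smooth atlas, subject to the classical transformation laws. Component
   functions are total functions on 'rV[R]_n; only their values on the image of
   the chart are meaningful, and all conditions are restricted to it. *)

(** * Smooth functions of n real variables *)

Definition partial (R : realType) (n : nat) (a : 'I_n)
    (f : 'rV[R]_n -> R) (x : 'rV[R]_n) : R := 'D_(delta_mx 0 a) f x.

Fixpoint Ck_on (R : realType) (n k : nat) (U : set 'rV[R]_n)
    (f : 'rV[R]_n -> R) : Prop :=
  match k with
  | 0%N => forall x, U x -> {for x, continuous f}
  | k'.+1 => (forall x, U x -> differentiable f x) /\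
             (forall a : 'I_n, Ck_on k' U (partial a f))
  end.

Definition smooth_on (R : realType) (n : nat) (U : set 'rV[R]_n)
    (f : 'rV[R]_n -> R) : Prop := forall k : nat, Ck_on k U f.

(** * Manifolds *)

Record chart (R : realType) (n : nat) (T : topologicalType) := Chart {
  dom : set T ;
  coord : T -> 'rV[R]_n ;
  coord_inv : 'rV[R]_n -> T ;
  dom_open : open dom ;
  coord_img_open : open (coord @` dom) ;
  coordK : forall p, dom p -> coord_inv (coord p) = p ;
  coord_cont : forall p, dom p -> {for p, continuous coord} ;
  coord_inv_cont : forall x, (coord @` dom) x -> {for x, continuous coord_inv}
}.

Definition transition (R : realType) (n : nat) (T : topologicalType)
    (c d : chart R n T) (x : 'rV[R]_n) : 'rV[R]_n := coord d (coord_inv c x).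

Record manifold (R : realType) (n : nat) := Manifold {
  carrier :> topologicalType ;
  chart_index : Type ;
  charts : chart_index -> chart R n carrier ;
  manifold_hausdorff : hausdorff_space carrier ;
  manifold_second_countable : @second_countable carrier ;
  manifold_connected : connected [set: carrier] ;
  charts_cover : forall p : carrier, exists i, dom (charts i) p ;
  transition_smooth : forall i j (a : 'I_n),
    smooth_on (coord (charts i) @` (dom (charts i) `&` dom (charts j)))
      (fun x => transition (charts i) (charts j) x 0 a)
}.

Definition in_chart (R : realType) (n : nat) (M : manifold R n)
    (i : chart_index M) (U : set M) : set 'rV[R]_n :=
  coord (charts i) @` (dom (charts i) `&` U).

Definition overlap (R : realType) (n : nat) (M : manifold R n)
    (i j : chart_index M) : set 'rV[R]_n := in_chart i (dom (charts j)).

Definition change (R : realType) (n : nat) (M : manifold R n)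
    (i j : chart_index M) : 'rV[R]_n -> 'rV[R]_n :=
  transition (charts i) (charts j).

(* Entry (a, b) is the derivative of the a-th coordinate of chart j with respect
   to the b-th coordinate of chart i. *)
Definition Jac (R : realType) (n : nat) (M : manifold R n)
    (i j : chart_index M) (x : 'rV[R]_n) : 'M[R]_n :=
  \matrix_(a < n, b < n) partial b (fun y => change i j y 0 a) x.

Definition on_open_dense (T : topologicalType) (P : T -> Prop) : Prop :=
  exists O : set T, [/\ open O, dense O & forall p, O p -> P p].

(** * Functions, vectors, densities and tensors *)

Definition fun_in (R : realType) (n : nat) (M : manifold R n) (B : M -> R)
    (i : chart_index M) (x : 'rV[R]_n) : R := B (coord_inv (charts i) x).

Definition smooth_function (R : realType) (n : nat) (M : manifold R n)
    (B : M -> R) : Prop := forall i, smooth_on (in_chart i setT) (fun_in B i).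

(* B_a = nabla_a B *)
Definition dfun (R : realType) (n : nat) (M : manifold R n) (B : M -> R)
    (i : chart_index M) (x : 'rV[R]_n) (a : 'I_n) : R :=
  partial a (fun_in B i) x.

(* v lists the components of one vector at p in the charts whose domain contains
   p; its values at the other charts are irrelevant. *)
Definition tangent_vector (R : realType) (n : nat) (M : manifold R n) (p : M)
    (v : chart_index M -> 'cV[R]_n) : Prop :=
  forall i j, dom (charts i) p -> dom (charts j) p ->
    v j = Jac i j (coord (charts i) p) *m v i.

Definition nonzero_vector (R : realType) (n : nat) (M : manifold R n) (p : M)
    (v : chart_index M -> 'cV[R]_n) : Prop :=
  forall i, dom (charts i) p -> v i != 0.

(* A section of (Lambda^n TM)^2 with component s in the frame
   (d_1 /\ ... /\ d_n)^2 has component (det J)^2 s in the other chart; E(1) being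
   its positive (2n+2)-nd root, a section of E(w) is multiplied by the power
   w / (n + 1) of |det J|. *)
Definition density_factor (R : realType) (n : nat) (M : manifold R n) (w : R)
    (i j : chart_index M) (x : 'rV[R]_n) : R :=
  `|\det (Jac i j x)| `^ (w / n.+1%:R).

(* Sections of E(w) over U *)
Record density (R : realType) (n : nat) (M : manifold R n) (w : R)
    (U : set M) := Density {
  dens :> chart_index M -> 'rV[R]_n -> R ;
  dens_smooth : forall i, smooth_on (in_chart i U) (dens i) ;
  dens_change : forall i j x, in_chart i (dom (charts j) `&` U) x ->
    dens j (change i j x) = density_factor w i j x * dens i x
}.

(* Sections of S^2 TM(w) *)
Record weighted_sym2 (R : realType) (n : nat) (M : manifold R n) (w : R) :=
  WeightedSym2 {
  ws2 :> chart_index M -> 'rV[R]_n -> 'M[R]_n ;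
  ws2_smooth : forall i (a b : 'I_n),
    smooth_on (in_chart i setT) (fun x => ws2 i x a b) ;
  ws2_sym : forall i x, in_chart i setT x -> (ws2 i x)^T = ws2 i x ;
  ws2_change : forall i j x, overlap i j x ->
    ws2 j (change i j x) =
      density_factor w i j x *: (Jac i j x *m ws2 i x *m (Jac i j x)^T)
}.

(* Pseudo-Riemannian metrics of arbitrary signature, components g_{ab} *)
Record metric (R : realType) (n : nat) (M : manifold R n) := Metric {
  met :> chart_index M -> 'rV[R]_n -> 'M[R]_n ;
  met_smooth : forall i (a b : 'I_n),
    smooth_on (in_chart i setT) (fun x => met i x a b) ;
  met_sym : forall i x, in_chart i setT x -> (met i x)^T = met i x ;
  met_nondegenerate : forall i x, in_chart i setT x -> met i x \in unitmx ;
  met_change : forall i j x, overlap i j x ->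
    met i x = (Jac i j x)^T *m met j (change i j x) *m Jac i j x
}.

(** * Levi-Civita connection and curvature *)

(* g^{ab} *)
Definition imet (R : realType) (n : nat) (M : manifold R n) (g : metric M)
    (i : chart_index M) (x : 'rV[R]_n) : 'M[R]_n := invmx (g i x).

(* Gamma^a_{bc} *)
Definition christoffel (R : realType) (n : nat) (M : manifold R n)
    (g : metric M) (i : chart_index M) (x : 'rV[R]_n) (a b c : 'I_n) : R :=
  2^-1 * \sum_(d < n) imet g i x a d *
    (partial b (fun y => g i y d c) x + partial c (fun y => g i y d b) x
     - partial d (fun y => g i y b c) x).

(* riemann a b c d = R^a_{bcd}, with [nabla_c, nabla_d] v^a = R^a_{bcd} v^b *)
Definition riemann (R : realType) (n : nat) (M : manifold R n) (g : metric M)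
    (i : chart_index M) (x : 'rV[R]_n) (a b c d : 'I_n) : R :=
  partial c (fun y => christoffel g i y a d b) x
  - partial d (fun y => christoffel g i y a c b) x
  + \sum_(e < n) (christoffel g i x a c e * christoffel g i x e d b
                  - christoffel g i x a d e * christoffel g i x e c b).

(* R_{bd} = R^a_{bad} *)
Definition ricci (R : realType) (n : nat) (M : manifold R n) (g : metric M)
    (i : chart_index M) (x : 'rV[R]_n) (b d : 'I_n) : R :=
  \sum_(a < n) riemann g i x a b a d.

(* P_{bd} *)
Definition schouten (R : realType) (n : nat) (M : manifold R n) (g : metric M)
    (i : chart_index M) (x : 'rV[R]_n) (b d : 'I_n) : R :=
  ricci g i x b d / n.-1%:R.

(* P^a_b *)
Definition schouten_up (R : realType) (n : nat) (M : manifold R n)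
    (g : metric M) (i : chart_index M) (x : 'rV[R]_n) (a b : 'I_n) : R :=
  \sum_(c < n) imet g i x a c * schouten g i x c b.

(* W^a_{bcd}; depends only on the projective class of g *)
Definition weyl (R : realType) (n : nat) (M : manifold R n) (g : metric M)
    (i : chart_index M) (x : 'rV[R]_n) (a b c d : 'I_n) : R :=
  riemann g i x a b c d + (a == d)%:R * schouten g i x b c
  - (a == c)%:R * schouten g i x b d.

Definition in_weyl_nullity (R : realType) (n : nat) (M : manifold R n)
    (g : metric M) (p : M) (v : chart_index M -> 'cV[R]_n) : Prop :=
  tangent_vector p v /\
  forall i, dom (charts i) p -> forall a c d : 'I_n,
    \sum_(b < n) weyl g i (coord (charts i) p) a b c d * v i b 0 = 0.

Definition weyl_nullity_at (R : realType) (n : nat) (M : manifold R n)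
    (g : metric M) (p : M) : Prop :=
  exists v, nonzero_vector p v /\ in_weyl_nullity g p v.

Definition nullity_function (R : realType) (n : nat) (M : manifold R n)
    (g : metric M) (B : M -> R) : Prop :=
  forall p v, in_weyl_nullity g p v ->
  forall i, dom (charts i) p -> forall a : 'I_n,
    \sum_(b < n) schouten_up g i (coord (charts i) p) a b * v i b 0
    = B p * v i a 0.

Definition nonconstant_at (R : realType) (T : topologicalType) (B : T -> R)
    (p : T) : Prop := ~ (\forall q \near p, B q = B p).

Definition dfun_nonzero_at (R : realType) (n : nat) (M : manifold R n)
    (B : M -> R) (p : M) : Prop :=
  forall i, dom (charts i) p ->
    exists a : 'I_n, dfun B i (coord (charts i) p) a != 0.

(** * The metrisability equation *)

(* nabla_a sigma^{bc} for sigma in S^2 TM(w). The last term is the action of the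
   connection on E(w): nabla_a = partial_a + Gamma^d_{ad} on Lambda^n TM. *)
Definition nabla_sym2 (R : realType) (n : nat) (M : manifold R n)
    (g : metric M) (w : R) (s : weighted_sym2 M w)
    (i : chart_index M) (x : 'rV[R]_n) (a b c : 'I_n) : R :=
  partial a (fun y => s i y b c) x
  + \sum_(d < n) (christoffel g i x b a d * s i x d c
                  + christoffel g i x c a d * s i x b d)
  + (w / n.+1%:R) * (\sum_(d < n) christoffel g i x d a d) * s i x b c.

(* Trace-free part of T_a^{bc} = T a b c, symmetric in b and c *)
Definition trace_free (R : realType) (n : nat) (T : 'I_n -> 'I_n -> 'I_n -> R)
    (a b c : 'I_n) : R :=
  T a b c - n.+1%:R^-1 * ((a == b)%:R * (\sum_(d < n) T d d c)
                          + (a == c)%:R * (\sum_(d < n) T d d b)).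

Definition metrisability_solution (R : realType) (n : nat) (M : manifold R n)
    (g : metric M) (s : weighted_sym2 M (- 2%:R)) : Prop :=
  forall i x, in_chart i setT x -> forall a b c : 'I_n,
    trace_free (nabla_sym2 g s i x) a b c = 0.

(** * Metric projective structures *)

Definition open_interval (R : realType) (I : set R) : Prop :=
  [/\ open I, is_interval I & I !=set0].

Definition smooth1_at (R : realType) (f : R -> R) (t : R) : Prop :=
  forall k : nat, derivable (derive1n k f) t 1.

(* Affinely parametrised geodesics defined on the interval I *)
Definition geodesic (R : realType) (n : nat) (M : manifold R n)
    (g : metric M) (I : set R) (c : R -> M) : Prop :=
  (forall t, I t -> {for t, continuous c}) /\
  (forall t, I t -> forall i, dom (charts i) (c t) ->
    let x := fun (a : 'I_n) (s : R) => coord (charts i) (c s) 0 a in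
    (forall a, smooth1_at (x a) t) /\
    (forall a, derive1n 2 (x a) t
       + \sum_(b < n) \sum_(d < n) christoffel g i (coord (charts i) (c t)) a b d
           * derive1n 1 (x b) t * derive1n 1 (x d) t = 0)).

Definition reparametrisation (R : realType) (J I : set R) (phi : R -> R)
    : Prop :=
  set_bij J I phi /\
  (forall t, J t -> smooth1_at phi t /\ derive1n 1 phi t != 0).

Definition geodesics_included (R : realType) (n : nat) (M : manifold R n)
    (g h : metric M) : Prop :=
  forall (I : set R) (c : R -> M), open_interval I -> geodesic g I c ->
  exists (J : set R) (phi : R -> R),
    [/\ open_interval J, reparametrisation J I phi & geodesic h J (c \o phi)].

Definition projectively_equivalent (R : realType) (n : nat) (M : manifold R n)
    (g h : metric M) : Prop :=
  geodesics_included g h /\ geodesics_included h g.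

Definition metric_projective_structure (R : realType) (n : nat)
    (M : manifold R n) (m : set (metric M)) : Prop :=
  exists g : metric M, m = [set h | projectively_equivalent g h].

(** * The form of the solutions *)

(* sigma^a_b = g_{bc} sigma^{ac} *)
Definition lower_snd (R : realType) (n : nat) (M : manifold R n) (g : metric M)
    (w : R) (s : weighted_sym2 M w) (i : chart_index M) (x : 'rV[R]_n)
    (a b : 'I_n) : R := \sum_(c < n) g i x b c * s i x a c.

(* B^a = g^{ac} B_c *)
Definition grad (R : realType) (n : nat) (M : manifold R n) (g : metric M)
    (B : M -> R) (i : chart_index M) (x : 'rV[R]_n) (a : 'I_n) : R :=
  \sum_(c < n) imet g i x a c * dfun B i x c.

Definition locally_nu_delta_eps_BB (R : realType) (n : nat) (M : manifold R n)
    (g : metric M) (B : M -> R) (s : weighted_sym2 M (- 2%:R)) (p : M) : Prop :=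
  exists U : set M, [/\ open U, U p &
  exists (nu eps : density (- 2%:R) U),
    forall i x, in_chart i U x -> forall a b : 'I_n,
      lower_snd g s i x a b
      = nu i x * (a == b)%:R + eps i x * (grad g B i x a * dfun B i x b)].

(* Main.v *)
From HB Require Import structures.
Require Import Defs.
From mathcomp Require Import all_boot all_order all_algebra.
From mathcomp Require Import all_classical all_reals all_analysis.
From mathcomp Require Import ring lra.

(* In a chart write T^a_b = sigma^a_b and lambda = - mu, so that nabla_a sigma^{bc} =
   delta_a^b lambda^c + delta_a^c lambda^b, and let Z be the curvature of g minus B
   times the curvature of constant curvature 1; the Weyl nullity vectors are killed
   by Z. Contracting the integrability condition of the metrisability equation with
   such a vector gives nabla_c lambda^b = kappa delta_c^b - B T^b_c at nullity points,
   hence everywhere by density, and then every Z(x, y) commutes with T.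
   Differentiating once more, with the one-form a = dB and some one-form b,
     Z(x, y) lambda = b(x) y - b(y) x - a(x) T y + a(y) T x.
   Since Z(T x, y) = Z(x, T y), linear algebra shows that at each point with a <> 0
   either T lies in the span of the identity and grad B (x) dB, or T^2 = p T + q.
   In the second case the relation persists nearby; differentiating it and
   symmetrising, with E = T - p / 2, gives
     (2 lambda - dp)(x) g(E x, x) = (linear form)(x) g(x, x).
   As n >= 3, the quadratic form g has no linear factor, so E is a multiple of the
   identity or dp = 2 lambda; in the latter case a trace computation gives lambda = 0
   or T = nu + f lambda (x) lambda. Both force Z(x, y) lambda = 0, and the displayed
   formula then puts T in the span after all. *)

Set Implicit Arguments.
Unset Strict Implicit.
Unset Printing Implicit Defensive.

Import Order.TTheory GRing.Theory Num.Theory.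
Import numFieldNormedType.Exports.
(* [vector] also defines [coord]. *)
Import Defs.

Local Open Scope ring_scope.

(** * Linear algebra at a point *)

Section LinearForms.
Variables (R : realFieldType) (n : nat).
Implicit Types (a b : 'rV[R]_n) (x y : 'cV[R]_n) (A T G : 'M[R]_n).

(** The relation T^2 = p T + q cannot be refuted at a single point: it has to be differentiated, so
    it must hold on an open set with smooth p and q. The set where T misses the span therefore has
    to be the non-zero set of a smooth field, which is why the two coefficients are given by closed
    formulas in T, dB and grad B. In indefinite signature grad B may be null, so the trace of grad B
    (x) dB can vanish and one cannot project along grad B; the formulas use the Euclidean product of
    the chart instead, and uniqueness of the coefficients restores covariance. Subtracting B times
    constant curvature keeps all the symmetries of a curvature tensor and turns Weyl nullity into
    plain annihilation by Z. Pair symmetry together with Z T = T Z is what gives Z(T x, y) = Z(x, T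
    y). The weight of sigma enters only through the closed one-form tr Gamma, so it adds no
    curvature. Vectors are columns, one-forms are rows. *)

Definition ev a x : R := (a *m x) 0 0.

Lemma evDl a b x : ev (a + b) x = ev a x + ev b x.
Proof. by rewrite /ev mulmxDl mxE. Qed.
Lemma evDr a x y : ev a (x + y) = ev a x + ev a y.
Proof. by rewrite /ev mulmxDr mxE. Qed.
Lemma evNl a x : ev (- a) x = - ev a x.
Proof. by rewrite /ev mulNmx mxE. Qed.
Lemma evNr a x : ev a (- x) = - ev a x.
Proof. by rewrite /ev mulmxN mxE. Qed.
Lemma evZl c a x : ev (c *: a) x = c * ev a x.
Proof. by rewrite /ev -scalemxAl mxE. Qed.
Lemma evZr c a x : ev a (c *: x) = c * ev a x.
Proof. by rewrite /ev -scalemxAr mxE. Qed.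
Lemma evM a A x : ev (a *m A) x = ev a (A *m x).
Proof. by rewrite /ev mulmxA. Qed.
Lemma ev0l x : ev 0 x = 0.
Proof. by rewrite /ev mul0mx mxE. Qed.

Definition evE := (evDl, evDr, evNl, evNr, evZl, evZr).

Lemma mulcr (u : 'cV[R]_n) a x : u *m a *m x = ev a x *: u.
Proof. by rewrite -mulmxA [a *m x]mx11_scalar mul_mx_scalar. Qed.

Definition bas (i : 'I_n) : 'cV[R]_n := delta_mx i 0.

Lemma mul_bas m (A : 'M[R]_(m, n)) i : A *m bas i = col i A.
Proof. by rewrite colE. Qed.

Lemma ev_bas a i : ev a (bas i) = a 0 i.
Proof. by rewrite /ev mul_bas mxE. Qed.

Lemma mulmx_ext m (A A' : 'M[R]_(m, n)) : (forall x, A *m x = A' *m x) -> A = A'.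
Proof.
move=> h; apply/matrixP=> i j; move/matrixP/(_ i 0): (h (bas j)).
by rewrite !mul_bas !mxE.
Qed.

Lemma ev_ext a b : (forall x, ev a x = ev b x) -> a = b.
Proof.
by move=> h; apply/rowP=> i; move: (h (bas i)); rewrite !ev_bas.
Qed.

Lemma row_neq0 a : a != 0 -> exists i, a 0 i != 0.
Proof.
move=> a0; apply/existsP; apply: contraNT a0; rewrite negb_exists => /forallP h.
by apply/eqP/rowP=> i; rewrite mxE; apply/eqP; move: (h i); rewrite negbK.
Qed.

Lemma col_neq0 x : x != 0 -> exists i, x i 0 != 0.
Proof.
move=> x0; have [|i] := @row_neq0 x^T; last by rewrite mxE; exists i.
by apply: contraNneq x0 => h; rewrite -[x]trmxK h trmx0.
Qed.

Lemma ev_neq0 a : a != 0 -> exists x, ev a x = 1.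
Proof.
move=> /row_neq0[i ai].
by exists ((a 0 i)^-1 *: bas i); rewrite evZr ev_bas mulVf.
Qed.

Lemma factor_ker m (A : 'M[R]_(m, n)) a : a != 0 ->
  (forall x, ev a x = 0 -> A *m x = 0) -> exists u : 'cV[R]_m, A = u *m a.
Proof.
move=> /ev_neq0[x0 ax0] h; exists (A *m x0); apply: mulmx_ext => x.
rewrite -mulmxA [a *m x]mx11_scalar mul_mx_scalar -/(ev a x).
have : A *m (x - ev a x *: x0) = 0 by apply: h; rewrite !evE ax0; ring.
by rewrite mulmxBr -scalemxAr => /eqP; rewrite subr_eq0 => /eqP.
Qed.

Lemma form_ker a b : a != 0 -> (forall x, ev a x = 0 -> ev b x = 0) ->
  exists c, b = c *: a.
Proof.
move=> a0 h; have [|u ->] := @factor_ker _ b a a0.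
  move=> x /h; rewrite /ev => e.
  by rewrite [b *m x]mx11_scalar e raddf0.
by exists (u 0 0); rewrite [in LHS](mx11_scalar u) mul_scalar_mx.
Qed.

(** The kernel is a hyperplane, of dimension at least two because n > 2. With a_i nonzero and j, k
    two further indices, the two witnesses are told apart by their entries j and k. *)
Lemma ker_independent a : (2 < n)%N -> a != 0 -> exists y1 y2,
  [/\ ev a y1 = 0, ev a y2 = 0 &
      forall c1 c2, c1 *: y1 + c2 *: y2 = 0 -> c1 = 0 /\ c2 = 0].
Proof.
move=> n2 /row_neq0[i ai].
have [j ji] : exists j, j != i.
  apply/existsP; rewrite -negb_forall; apply/negP => /forallP h.
  have : (#|'I_n| <= 1)%N.
    by apply/card_le1P => k _; move=> l; rewrite (eqP (h l)) (eqP (h k)) !inE eqxx.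
  by rewrite card_ord leqNgt (ltn_trans _ n2).
have [k /andP[ki kj]] : exists k, (k != i) && (k != j).
  apply/existsP; rewrite -[X in is_true X]negbK negb_exists; apply/negP => /forallP h.
  have : (#|'I_n| <= #|[set i; j]|)%N.
    apply: subset_leq_card; apply/fintype.subsetP => k _; rewrite !inE.
    by move: (h k); rewrite negb_and !negbK.
  by rewrite card_ord cards2 leqNgt (leq_trans _ n2) // ltnS; case: (_ != _).
exists (a 0 i *: bas j - a 0 j *: bas i), (a 0 i *: bas k - a 0 k *: bas i).
split; first by rewrite !evE !ev_bas; ring.
  by rewrite !evE !ev_bas; ring.
move=> c1 c2 /colP h; split.
  move: (h j); rewrite !mxE !eqxx (negPf ji) [j == k]eq_sym (negPf kj) /= => e.
  by apply: (mulIf ai); rewrite mul0r -[RHS]e; ring.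
move: (h k); rewrite !mxE !eqxx (negPf ki) (negPf kj) /= => e.
by apply: (mulIf ai); rewrite mul0r -[RHS]e; ring.
Qed.

End LinearForms.

(* Unlike [mxE], these do not unfold products. *)
Section Entries.
Variables (R : pzRingType) (m n : nat).
Implicit Types A C : 'M[R]_(m, n).
Lemma entD A C i j : (A + C) i j = A i j + C i j. Proof. by rewrite mxE. Qed.
Lemma entN A i j : (- A) i j = - A i j. Proof. by rewrite mxE. Qed.
Lemma entZ c A i j : (c *: A) i j = c * A i j. Proof. by rewrite mxE. Qed.
Lemma ent0 i j : (0 : 'M[R]_(m, n)) i j = 0. Proof. by rewrite mxE. Qed.
End Entries.
Definition entE := (entD, entN, entZ, ent0).

(** * Self-adjoint endomorphisms that are scalar on a hyperplane *)

Section Span.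
Variables (R : realFieldType) (n : nat).
Hypothesis n2 : (2 < n)%N.
Variables (G : 'M[R]_n) (Gu : G \in unitmx).
Implicit Types (a b : 'rV[R]_n) (x y : 'cV[R]_n) (T : 'M[R]_n).

Definition selfadj T := (G *m T)^T = G *m T.

Lemma selfadjB T c : G^T = G -> selfadj T -> selfadj (T - c%:M).
Proof.
by move=> Gs h; rewrite /selfadj mulmxBr linearB /= h mul_mx_scalar linearZ /= Gs.
Qed.

(** Write T = u a. Symmetry of G u a forces G u to be proportional to a^T; evaluating at [x0] with
    a(x0) = 1 gives the factor. *)
Lemma selfadj_rank1 T a : selfadj T -> a != 0 ->
  (forall x, ev a x = 0 -> T *m x = 0) -> exists e, T = e *: (invmx G *m a^T *m a).
Proof.
move=> sT a0 h; have [u Tu] := factor_ker a0 h; have [x0 ax0] := ev_neq0 a0.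
exists ((u^T *m (G^T *m x0)) 0 0).
have : G *m T *m x0 = G *m u by rewrite -mulmxA Tu mulcr ax0 scale1r.
rewrite -sT Tu !trmx_mul -!mulmxA; move: (u^T *m _) => c.
rewrite {1}[c]mx11_scalar mul_mx_scalar => e.
by rewrite -{1}[u](mulKmx Gu) -e -scalemxAr -!scalemxAl -mulmxA.
Qed.

(** Polarising the hypothesis at [y + x1] gives T y = c y up to a multiple of s x1, where s = ph(y)
    - c th(y). Comparison with the hypothesis at y yields s (th(y) x1 - th(x1) y) = 0, and either
    factor being zero makes s x1 vanish. *)
Lemma eigen_ker T a x1 : ev a x1 = 0 ->
  (exists th ph : 'rV_n, ev th x1 != 0 /\
    forall y, ev a y = 0 -> ev th y *: (T *m y) = ev ph y *: y) ->
  exists c, forall y, ev a y = 0 -> T *m y = c *: y.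
Proof.
move=> ax1 [th [ph [t1 h]]].
have eig y : ev a y = 0 -> ev th y != 0 -> T *m y = (ev ph y / ev th y) *: y.
  by move=> ay ty; rewrite mulrC -scalerA -h // scalerA mulVf // scale1r.
pose c := ev ph x1 / ev th x1; exists c.
have Tx1 := eig _ ax1 t1.
have h2 y : ev a y = 0 ->
   ev th x1 *: (T *m y) = (ev th x1 * c) *: y + (ev ph y - c * ev th y) *: x1.
  move=> ay.
  have e1 := h y ay; have e2 := h x1 ax1.
  have := h (y + x1); rewrite !evE ay ax1 addr0 => /(_ erefl).
  rewrite mulmxDr => /colP e3; apply/colP=> i.
  move: (e3 i) (congr1 (fun v : 'cV_n => v i 0) e1) (congr1 (fun v : 'cV_n => v i 0) e2).
  have : (T *m x1) i 0 = c * x1 i 0 by rewrite Tx1 !entE.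
  have : ev ph x1 = c * ev th x1 by rewrite /c divfK.
  rewrite !entE => -> -> g1 g2 _.
  have -> : ev th x1 * c * y i 0 + (ev ph y - c * ev th y) * x1 i 0 =
    (ev ph y + c * ev th x1) * (y i 0 + x1 i 0) - ev ph y * y i 0 - c * ev th x1 * x1 i 0 - c * ev th y * x1 i 0 by ring.
  rewrite -g1 -g2; ring.
move=> y ay.
pose s := ev ph y - c * ev th y.
suff s0 : s *: x1 = 0.
  have := h2 y ay; rewrite -/s s0 addr0 -scalerA => /(congr1 (fun z => (ev th x1)^-1 *: z)).
  by rewrite !scalerA mulVf // mulKf // scale1r.
have k : s *: (ev th y *: x1 - ev th x1 *: y) = 0.
  apply/colP=> i; have /colP/(_ i) := h2 y ay; have /colP/(_ i) := h y ay.
  rewrite !entE -/s => e1 e2.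
  have -> : s * (ev th y * x1 i 0 - ev th x1 * y i 0) =
    ev th y * (ev th x1 * c * y i 0 + s * x1 i 0) - ev th x1 * (ev ph y * y i 0).
    by rewrite /s; ring.
  by rewrite -e1 -e2; ring.
move/eqP: k; rewrite scaler_eq0 => /orP[/eqP->|]; first by rewrite scale0r.
rewrite subr_eq0 => /eqP e.
have yx : y = (ev th y / ev th x1) *: x1.
  by rewrite mulrC -scalerA e scalerA mulVf // scale1r.
rewrite /s yx !evZr /c.
have -> : forall k, k * ev ph x1 - ev ph x1 / ev th x1 * (k * ev th x1) = 0.
  by move=> k'; field.
by rewrite scale0r.
Qed.

Lemma linear_self_eq0 a ph : a != 0 ->
  (forall x, ev a x = 0 -> ev ph x *: x = 0) -> exists c, ph = c *: a.
Proof.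
move=> a0 h; apply: form_ker => // x /h /eqP.
by rewrite scaler_eq0 => /orP[/eqP->//|/eqP->]; rewrite /ev mulmx0 mxE.
Qed.

(** For a = dB the column [invmx G *m a^T] is grad B, so this is the form claimed for sigma^a_b. *)
Definition in_span T a := exists nu e, T = nu%:M + e *: (invmx G *m a^T *m a).

Lemma in_span_ker T a c : G^T = G -> selfadj T -> a != 0 ->
  (forall x, ev a x = 0 -> T *m x = c *: x) -> in_span T a.
Proof.
move=> Gs sT a0 h; have [||e Te] := @selfadj_rank1 (T - c%:M) a _ a0.
- exact: selfadjB.
- by move=> x /h; rewrite mulmxBl mul_scalar_mx => ->; rewrite subrr.
by exists c, e; rewrite -Te addrC subrK.
Qed.

(** On the diagonal of ker a the identity reads th(x) T x = ph(x) x. If th is nonzero somewhere on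
    ker a, T is scalar there. Otherwise th and ph are multiples of a, and the identity says that
    a(y) D x + a(x) D y = 0 for D = T^2 - p T - q; a vector with a(x0) = 1 then forces D = 0. *)
Lemma quadratic_or_span T a th ph : G^T = G -> selfadj T -> a != 0 ->
  (forall x y, ev a y *: (T *m T *m x) + ev a x *: (T *m T *m y) =
     ev th x *: (T *m y) + ev th y *: (T *m x) - ev ph x *: y - ev ph y *: x) ->
  in_span T a \/
  exists p q, [/\ th = p *: a, ph = - (q *: a) & T *m T = p *: T + q%:M].
Proof.
move=> Gs sT a0 H.
have H0 x : ev a x = 0 -> ev th x *: (T *m x) = ev ph x *: x.
  move=> ax; move/colP: (H x x) => e; apply/colP=> i; move: (e i).
  rewrite !entE ax; lra.
have [[x1 ax1 t1]|th0] :
    (exists2 x1, ev a x1 = 0 & ev th x1 != 0) \/ (forall x, ev a x = 0 -> ev th x = 0).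
(* The vectors a_i e_j - a_j e_i lie in ker a, and a form vanishing on all of them is a multiple of
   a. *)
- case: (boolP [exists i, [exists j, ev th (a 0 i *: bas R j - a 0 j *: bas R i) != 0]]).
    move=> /existsP[i /existsP[j ij]]; left; eexists; last exact: ij.
    by rewrite !evE !ev_bas; ring.
  rewrite negb_exists => /forallP k; right.
  have [x0 ax0] := ev_neq0 a0.
  have {}k i j : a 0 i * th 0 j = a 0 j * th 0 i.
    move: (k i); rewrite negb_exists => /forallP/(_ j); rewrite negbK => /eqP.
    by rewrite !evE !ev_bas => /eqP; rewrite subr_eq0 => /eqP.
  have e : th = ev th x0 *: a.
    apply/rowP=> j; rewrite entE /ev !mxE mulr_suml -[LHS]mul1r -ax0 /ev mxE mulr_suml.
    apply: eq_bigr => i _; rewrite mulrAC k; ring.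
  by move=> x ax; rewrite e evZl ax mulr0.
  have [|c hc] := @eigen_ker T a x1 ax1; first by exists th, ph; split.
  by left; apply: in_span_ker hc.
have [p thp] := form_ker a0 th0.
have [|r phr] := @linear_self_eq0 a ph a0.
  by move=> x ax; rewrite -H0 // th0 // scale0r.
right; exists p, (- r); split=> //; first by rewrite scaleNr opprK.
have [x0 ax0] := ev_neq0 a0.
pose D := T *m T - p *: T - (- r)%:M.
suff : D = 0 by move=> /eqP; rewrite /D -addrA -opprD subr_eq0 => /eqP.
have HD x y : ev a y *: (D *m x) + ev a x *: (D *m y) = 0.
  move/colP: (H x y) => e; apply/colP=> i; move: (e i).
  rewrite thp phr /D !mulmxBl !mul_scalar_mx -!scalemxAl !entE !evZl; lra.
have D0 : D *m x0 = 0.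
  move/colP: (HD x0 x0) => e; apply/colP=> i; move: (e i).
  by rewrite ax0 !entE; lra.
apply: mulmx_ext => x; rewrite mul0mx.
by have := HD x x0; rewrite D0 scaler0 addr0 ax0 scale1r.
Qed.

(* The case [Z(x, y) lambda = 0] of the curvature identity. *)
Lemma span_of_commutator T a b : G^T = G -> selfadj T -> a != 0 ->
  (forall x y, ev b x *: y - ev b y *: x - ev a x *: (T *m y) + ev a y *: (T *m x) = 0) ->
  in_span T a.
Proof.
move=> Gs sT a0 H.
(* For x and y in ker a the identity is b(x) y = b(y) x, which two independent choices of y
   contradict unless b(x) = 0. *)
have [c bc] : exists c, b = c *: a.
  apply: form_ker => // x ax.
  have [y1 [y2 [ay1 ay2 ind]]] := ker_independent n2 a0.
  have e1 := H x y1; have e2 := H x y2.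
  rewrite ax ay1 !scale0r subr0 addr0 in e1; rewrite ax ay2 !scale0r subr0 addr0 in e2.
  have [//|/eqP bx] := eqVneq (ev b x) 0.
  have k : (- ev b y2) *: (ev b x *: y1) + ev b y1 *: (ev b x *: y2) = 0.
    move/eqP: e1; rewrite subr_eq0 => /eqP->; move/eqP: e2; rewrite subr_eq0 => /eqP->.
    by apply/colP => i; rewrite !entE; ring.
  move: k; rewrite !scalerA => /ind [_ /eqP].
  rewrite mulf_eq0 => /orP[/eqP b1|/eqP//].
  move/eqP: e1; rewrite b1 scale0r subr0 scaler_eq0 => /orP[/eqP//|/eqP y10].
  have [/eqP] := ind 1 0 ltac:(by rewrite y10 scaler0 scale0r add0r).
  by rewrite oner_eq0.
apply: (@in_span_ker _ _ c) => // y ay.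
have [x0 ax0] := ev_neq0 a0.
have := H x0 y; rewrite bc !evZl ay ax0 mulr1 mulr0 !scale0r subr0 addr0 scale1r.
by move=> /eqP; rewrite subr_eq0 => /eqP.
Qed.

End Span.

(** * Quadratic forms and their linear factors *)

Section Bilinear.
Variables (R : realFieldType) (n : nat).
Implicit Types (a b : 'rV[R]_n) (x y z : 'cV[R]_n) (Q : 'M[R]_n).

Definition bil Q x y : R := (x^T *m Q *m y) 0 0.

Lemma bilDl Q x y z : bil Q (x + y) z = bil Q x z + bil Q y z.
Proof. by rewrite /bil linearD /= !mulmxDl mxE. Qed.
Lemma bilDr Q x y z : bil Q z (x + y) = bil Q z x + bil Q z y.
Proof. by rewrite /bil mulmxDr mxE. Qed.
Lemma bilNl Q x z : bil Q (- x) z = - bil Q x z.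
Proof. by rewrite /bil linearN /= !mulNmx mxE. Qed.
Lemma bilNr Q x z : bil Q z (- x) = - bil Q z x.
Proof. by rewrite /bil mulmxN mxE. Qed.
Lemma bilZl Q c x z : bil Q (c *: x) z = c * bil Q x z.
Proof. by rewrite /bil linearZ /= -!scalemxAl mxE. Qed.
Lemma bilZr Q c x z : bil Q z (c *: x) = c * bil Q z x.
Proof. by rewrite /bil -scalemxAr mxE. Qed.
Lemma bilMDl Q Q' x y : bil (Q + Q') x y = bil Q x y + bil Q' x y.
Proof. by rewrite /bil mulmxDr mulmxDl mxE. Qed.
Lemma bilMZl c Q x y : bil (c *: Q) x y = c * bil Q x y.
Proof. by rewrite /bil -scalemxAr -scalemxAl mxE. Qed.
Lemma bilM Q Q' x y : bil (Q *m Q') x y = bil Q x (Q' *m y).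
Proof. by rewrite /bil !mulmxA. Qed.
Lemma bil_sym Q x y : Q^T = Q -> bil Q x y = bil Q y x.
Proof.
move=> Qs; rewrite /bil; have -> : y^T *m Q *m x = (x^T *m Q *m y)^T.
  by rewrite !trmx_mul trmxK Qs mulmxA.
by rewrite [in RHS]mxE.
Qed.
Lemma ev_bil Q x y : ev (x^T *m Q) y = bil Q x y.
Proof. by []. Qed.

Definition bilE := (bilDl, bilDr, bilNl, bilNr, bilZl, bilZr).

Lemma bil_bas Q i j : bil Q (bas R i) (bas R j) = Q i j.
Proof. by rewrite /bil /bas trmx_delta -rowE -colE !mxE. Qed.

Lemma bil_eq0 Q : (forall x y, bil Q x y = 0) -> Q = 0.
Proof. by move=> h; apply/matrixP=> i j; rewrite -bil_bas h mxE. Qed.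

Lemma polar_eq0 Q a : Q^T = Q -> (forall x, ev a x = 0 -> bil Q x x = 0) ->
  forall x y, ev a x = 0 -> ev a y = 0 -> bil Q x y = 0.
Proof.
move=> Qs h x y ax ay.
have := h (x + y); rewrite !evE ax ay addr0 => /(_ erefl).
by rewrite !bilE (h _ ax) (h _ ay) (bil_sym y x Qs); lra.
Qed.

(** If b(x0) is nonzero, Q vanishes wherever b does not. For y in ker b this applies to x0, x0 + y
    and x0 - y, and the parallelogram identity gives Q(y, y) = 0. *)
Lemma linear_quadratic_eq0 Q a b :
  (forall x, ev a x = 0 -> ev b x * bil Q x x = 0) ->
  (forall x, ev a x = 0 -> ev b x = 0) \/ (forall x, ev a x = 0 -> bil Q x x = 0).
Proof.
move=> h.
have [[x0 ax0 b0]|nb] :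
    (exists2 x1, ev a x1 = 0 & ev b x1 != 0) \/ (forall x, ev a x = 0 -> ev b x = 0).
- have [->|a0] := eqVneq a 0.
    have [->|/ev_neq0[x bx]] := eqVneq b 0; first by right=> x _; rewrite ev0l.
    by left; exists x; rewrite ?ev0l // bx oner_neq0.
  have [x0 ax0] := ev_neq0 a0.
  (* This form is b composed with the projection x - a(x) x0 onto ker a, so it is zero exactly when
     b vanishes on ker a. *)
  have [e|ne] := eqVneq (b - ev b x0 *: a) 0.
    right=> x ax; move/eqP: e; rewrite subr_eq0 => /eqP->.
    by rewrite evZl ax mulr0.
  have [x bx] := ev_neq0 ne; left; exists (x - ev a x *: x0).
    by rewrite !evE ax0; ring.
  by move: bx; rewrite !evE => bx; rewrite mulrC bx oner_neq0.
- right.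
  have Q0 y : ev a y = 0 -> ev b y != 0 -> bil Q y y = 0.
    by move=> ay bY; move/eqP: (h y ay); rewrite mulf_eq0 (negPf bY) => /eqP.
  move=> y ay; have [by0|] := eqVneq (ev b y) 0; last exact: Q0.
  have e1 : bil Q (x0 + y) (x0 + y) = 0.
    by apply: Q0; rewrite !evE ?ax0 ?ay ?addr0 // by0 addr0.
  have e2 : bil Q (x0 - y) (x0 - y) = 0.
    by apply: Q0; rewrite !evE ?ax0 ?ay ?oppr0 ?addr0 // by0 oppr0 addr0.
  have e3 := Q0 x0 ax0 b0.
  by move: e1 e2; rewrite !bilE e3; lra.
by left.
Qed.

Lemma lin_bas (V : lmodType R) (f : 'cV[R]_n -> V) :
  (forall c x y, f (c *: x + y) = c *: f x + f y) ->
  (forall i, f (bas R i) = 0) -> forall x, f x = 0.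
Proof.
move=> fl f0 x; have -> : x = \sum_i x i 0 *: bas R i.
  by rewrite [LHS]matrix_sum_delta; apply: eq_bigr => i _; rewrite big_ord1.
have F0 : f 0 = 0.
  by have := fl (-1) 0 0; rewrite scaler0 addr0 scaleN1r addNr.
elim/big_ind: _ => // [y z fy fz|i _].
  by rewrite -[y]scale1r fl fy fz scaler0 addr0.
by rewrite -[_ *: _]addr0 fl f0 scaler0 F0 addr0.
Qed.

End Bilinear.

Section Quadratic.
Variables (R : realFieldType) (n : nat).
Hypothesis n2 : (2 < n)%N.
Variables (G : 'M[R]_n) (Gu : G \in unitmx) (Gs : G^T = G).
Implicit Types (a b : 'rV[R]_n) (x y z l : 'cV[R]_n) (T : 'M[R]_n).

Lemma nondeg x : (forall y, bil G x y = 0) -> x = 0.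
Proof.
move=> h; have : x^T *m G = 0 by apply: ev_ext => y; rewrite ev_bil h ev0l.
move=> /(congr1 (mulmxr (invmx G))) /=; rewrite mulmxK // mul0mx.
by move=> /(congr1 trmx); rewrite trmxK trmx0.
Qed.

(** On an isotropic hyperplane, G(y, -) is a multiple of a for each y in it; two independent y then
    combine to a nonzero vector in the radical of G. In dimension two null lines are isotropic
    hyperplanes, hence the bound on n. *)
Lemma no_isotropic_hyperplane a : a != 0 ->
  ~ (forall x, ev a x = 0 -> bil G x x = 0).
Proof.
move=> a0 /(polar_eq0 Gs) h; have [y1 [y2 [ay1 ay2 ind]]] := ker_independent n2 a0.
have k y : ev a y = 0 -> exists c, y^T *m G = c *: a.
  by move=> ay; apply: form_ker => // x ax; rewrite ev_bil h.
have [c1 e1] := k _ ay1; have [c2 e2] := k _ ay2.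
have e : c2 *: y1 + (- c1) *: y2 = 0.
  apply: nondeg => y; rewrite -ev_bil linearD !linearZ /= mulmxDl -!scalemxAl e1 e2.
  by rewrite !evE; ring.
have [c20 _] := ind _ _ e.
move: e2; rewrite c20 scale0r => e2.
have y20 : y2 = 0 by apply: nondeg => y; rewrite -ev_bil e2 ev0l.
have [_ /eqP] := ind 0 1 ltac:(by rewrite y20 scaler0 scale0r add0r).
by rewrite oner_eq0.
Qed.

(** On ker a the product of b and the quadratic form G vanishes, and G does not vanish there, so b =
    c a. Then a times Q - c G is zero everywhere. *)
Lemma linear_quadratic_proportional (Q : 'M[R]_n) a b : Q^T = Q -> a != 0 ->
  (forall x, ev a x * bil Q x x = ev b x * bil G x x) -> exists c, Q = c *: G.
Proof.
move=> Qs a0 h.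
have [c bc] : exists c, b = c *: a.
  apply: form_ker => //; have [|//|k] := @linear_quadratic_eq0 _ _ G a b.
    by move=> x ax; rewrite -h ax mul0r.
  by case: (no_isotropic_hyperplane a0).
exists c; pose D := Q + (- c) *: G.
have Ds : D^T = D by rewrite /D linearD linearZ /= Qs Gs.
suff : D = 0 by rewrite /D scaleNr => /eqP; rewrite subr_eq0 => /eqP.
have [|h1|h1] := @linear_quadratic_eq0 _ _ D 0 a.
- by move=> x _; rewrite /D bilMDl bilMZl mulrDr h bc evZl; ring.
- case/eqP: a0; apply: ev_ext => x; rewrite ev0l; apply: h1; exact: ev0l.
- by apply: bil_eq0 => x y; apply: (polar_eq0 Ds h1); apply: ev0l.
Qed.

(* The endomorphism with components of z (x) l + l (x) z, one index lowered *)
Definition symprod l z : 'M[R]_n := z *m (l^T *m G) + l *m (z^T *m G).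

Lemma mul_symprod l z x : symprod l z *m x = bil G l x *: z + bil G z x *: l.
Proof. by rewrite mulmxDl !mulcr !ev_bil. Qed.

Lemma trace_symprod T l z : \tr (T *m symprod l z) = bil (G *m T) l z + bil (G *m T) z l.
Proof.
rewrite mulmxDr linearD /= !mulmxA ![\tr (_ *m _ *m G)]mxtrace_mulC !mulmxA.
rewrite ![\tr (_ *m _ *m _^T)]mxtrace_mulC !mulmxA.
by rewrite /mxtrace !big_ord1 /bil !mulmxA.
Qed.

(* Evaluating the hypothesis on z = x and using that the quadratic form of [G] has no
   linear factor gives P = 2 l; the trace then makes l an eigenvector of E. *)
Lemma trace_free_part_rank1 E l P D : selfadj G E ->
  (forall z, E *m symprod l z + symprod l z *m E = ev P z *: E + (ev D z)%:M) ->
  (exists c, E = c%:M) \/ l = 0 \/ exists nu f, E = nu%:M + f *: (l *m l^T *m G).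
Proof.
move=> sE H.
have GEs x y : bil (G *m E) x y = bil (G *m E) y x by exact: bil_sym.
have Gss x y : bil G x y = bil G y x by exact: bil_sym.
pose w := l^T *m (G *m E).
have H1 x y z : bil G l x * bil (G *m E) y z + bil G z x * ev w y
     + ev w x * bil G y z + bil (G *m E) z x * bil G l y
   = ev P z * bil (G *m E) x y + ev D z * bil G x y.
  have e : E *m (symprod l z *m x) + symprod l z *m (E *m x)
         = ev P z *: (E *m x) + ev D z *: x.
    by rewrite !mulmxA -mulmxDl H mulmxDl -scalemxAl mul_scalar_mx.
  move: (congr1 (bil G y) e); rewrite !mul_symprod mulmxDr -!scalemxAr !bilE -!bilM.
  rewrite !ev_bil (GEs x y) (GEs l y) (Gss x y) (Gss l y) => <-.
  ring.
(* Setting x = y = z in [H1] leaves (2 l - P)(x) E(x, x) = (D - 2 w)(x) G(x, x), with l lowered by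
   G. *)
pose a := 2 *: (l^T *m G) - P.
have [P2|a0] := eqVneq a 0; last first.
  left; have [||c Ec] := @linear_quadratic_proportional (G *m E) a (D - 2 *: w) _ a0.
  - by [].
  - move=> x; have := H1 x x x; rewrite /a !evE ev_bil; lra.
  exists c; rewrite -[E](mulKmx Gu) Ec -scalemxAr mulVmx //.
  by rewrite -mul_scalar_mx mulmx1.
have {P2} Pl : P = 2 *: (l^T *m G) by move/eqP: P2; rewrite subr_eq0 => /eqP.
have Dw : D = 2 *: w.
  apply/eqP; rewrite -subr_eq0; apply/negPn/negP => d0.
  have [|h|h] := @linear_quadratic_eq0 _ _ G 0 (D - 2 *: w).
  - by move=> x _; have := H1 x x x; rewrite Pl !evE ev_bil; lra.
  - by case/eqP: d0; apply: ev_ext => x; rewrite ev0l; apply: h; exact: ev0l.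
  - by apply: (no_isotropic_hyperplane d0) => x _; apply: h; exact: ev0l.
(* The trace of the hypothesis is 4 w = 2 (tr E) l + 2 n w, so w = - e l for this e, which is where
   n - 2 comes from. *)
pose e := \tr E / (n%:R - 2).
have n20 : n%:R - 2 != 0 :> R.
  by rewrite subr_eq0 eqr_nat; case: (ltngtP n 2) n2.
have we x : ev w x = - e * bil G l x.
  have /(congr1 mxtrace) := H x; rewrite linearD /= [in X in _ + X]mxtrace_mulC.
  rewrite trace_symprod GEs linearD linearZ /= mxtrace_scalar Pl Dw !evE ev_bil.
  rewrite GEs -/(ev w x) => t; apply: (mulIf n20).
  have en : \tr E = e * (n%:R - 2) by rewrite /e divfK.
  have wE : ev w x = bil (G *m E) l x by [].
  by move: t; rewrite en wE -[_ *+ n]mulr_natl; lra.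
pose F := G *m E + (- e) *: G.
have HF x y z : bil G l x * bil F y z + bil G l y * bil F z x = 2 * bil G l z * bil F x y.
  have := H1 x y z; rewrite Pl Dw !evE !we ev_bil /F !bilMDl !bilMZl (Gss z x); lra.
have Fs : F^T = F by rewrite /F linearD linearZ /= Gs sE.
(* The difference of [HF] and its copy with x and z exchanged is three times this identity; it says
   that F is a multiple of the square of the lowered l. *)
have HF2 x y z : bil G l x * bil F z y = bil G l z * bil F x y.
  have := HF x y z; have := HF z y x; rewrite (bil_sym y x Fs) (bil_sym y z Fs) (bil_sym z x Fs); lra.
have [->|l0] := eqVneq l 0; [by right; left|right; right].
have lG0 : l^T *m G != 0.
  apply: contraNneq l0 => h; apply/eqP/nondeg => y; by rewrite -ev_bil h ev0l.
have [x0 lx0] := ev_neq0 lG0; rewrite ev_bil in lx0.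
exists e, (bil F x0 x0).
have FE : F = bil F x0 x0 *: (G *m l *m l^T *m G).
  apply/eqP; rewrite -subr_eq0 -scaleNr; apply/eqP/bil_eq0 => x y.
  rewrite bilMDl bilMZl.
  have -> : bil (G *m l *m l^T *m G) x y = bil G l x * bil G l y.
    rewrite (Gss l x) /bil !mulmxA -mulmxA -mulmxA.
    rewrite [l^T *m _]mulmxA; set u := x^T *m G *m l; set v := l^T *m G *m y.
    by rewrite [u]mx11_scalar mul_scalar_mx !mxE eqxx mulr1n.
  have := HF2 x y x0; have := HF2 y x0 x0; rewrite lx0 (bil_sym x0 y Fs) => e1 e2.
  by rewrite mul1r in e1; rewrite mul1r in e2; rewrite -e2 -e1; ring.
have : G *m E = e *: G + bil F x0 x0 *: (G *m l *m l^T *m G).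
  by rewrite -FE /F scaleNr addrC subrK.
move=> /(congr1 (mulmx (invmx G))); rewrite mulKmx // => ->.
by rewrite mulmxDr -!scalemxAr mulVmx // !mulmxA mulVmx // mul1mx scalemx1.
Qed.

End Quadratic.

(** * Algebraic consequences of the curvature identity *)

Section Curvature.
Variables (R : realFieldType) (n : nat).
Hypothesis n2 : (2 < n)%N.
Variables (G : 'M[R]_n) (Gu : G \in unitmx) (Gs : G^T = G).
Variables (T : 'M[R]_n) (sT : selfadj G T) (l : 'cV[R]_n) (a b : 'rV[R]_n).
Variable (Z : 'I_n -> 'I_n -> 'M[R]_n).
Hypothesis a0 : a != 0.
Hypothesis ZT : forall c d, Z c d *m T = T *m Z c d.
Hypothesis Zanti : forall c d, (Z c d)^T *m G = - (G *m Z c d).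
Hypothesis Zpair : forall c d i j, (G *m Z c d) i j = (G *m Z i j) c d.
Hypothesis Zl : forall c d, Z c d *m l =
  b 0 c *: bas R d - b 0 d *: bas R c - a 0 c *: (T *m bas R d) + a 0 d *: (T *m bas R c).

(** Pair symmetry moves the form indices of Z to its endomorphism indices, where the claim becomes
    T^T G Z = G Z T; this follows from self-adjointness of T and its commuting with Z. *)
Lemma shift_T c d : \sum_e T e c *: Z e d = \sum_e T e d *: Z c e.
Proof.
rewrite -[LHS](mulKmx Gu) -[RHS](mulKmx Gu); congr (_ *m _).
apply/matrixP=> i j; rewrite !mulmx_sumr !summxE.
transitivity ((T^T *m (G *m Z i j)) c d).
  by rewrite [RHS]mxE; apply: eq_bigr => e _; rewrite -scalemxAr !entE Zpair [in RHS]mxE.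
have -> : T^T *m (G *m Z i j) = (G *m Z i j) *m T.
  by move: sT; rewrite /selfadj trmx_mul Gs mulmxA => ->; rewrite -!mulmxA ZT.
by rewrite mxE; apply: eq_bigr => e _; rewrite -scalemxAr !entE Zpair mulrC.
Qed.

Lemma sum_bas (x : 'cV[R]_n) : \sum_e x e 0 *: bas R e = x.
Proof.
rewrite [RHS]matrix_sum_delta; apply: eq_bigr => i _.
by rewrite big_ord1.
Qed.

Lemma mul_sum_bas m (A : 'M[R]_(m, n)) (x : 'cV[R]_n) :
  \sum_e x e 0 *: (A *m bas R e) = A *m x.
Proof.
by rewrite -{2}[x]sum_bas mulmx_sumr; apply: eq_bigr => e _; rewrite scalemxAr.
Qed.

Lemma sum_ev (f : 'rV[R]_n) (x : 'cV[R]_n) : \sum_e x e 0 * f 0 e = ev f x.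
Proof. by rewrite /ev mxE; apply: eq_bigr => e _; rewrite mulrC. Qed.

(** Insert the formula [Zl] into Z(T x, y) l = Z(x, T y) l: the result is the hypothesis of
    [quadratic_or_span] with th = b + a T and ph = b T. *)
Lemma curvature_alternative :
  in_span G T a \/
  exists p q, [/\ b + a *m T = p *: a, b *m T = - (q *: a) & T *m T = p *: T + q%:M].
Proof.
apply: quadratic_or_span => //.
pose F x y := ev a y *: (T *m T *m x) + ev a x *: (T *m T *m y) -
  (ev (b + a *m T) x *: (T *m y) + ev (b + a *m T) y *: (T *m x)
   - ev (b *m T) x *: y - ev (b *m T) y *: x).
suff FF x y : F x y = 0.
  by move=> x y; apply/eqP; rewrite -subr_eq0; apply/eqP; exact: FF.
rewrite /F; move: x; apply: lin_bas => [k x x'|c].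
  by rewrite !mulmxDr -!scalemxAr !evE; apply/colP=> i; rewrite !entE; ring.
move: y; apply: lin_bas => [k x x'|d].
  by rewrite !mulmxDr -!scalemxAr !evE; apply/colP=> i; rewrite !entE; ring.
have e1 : \sum_e T e c *: (Z e d *m l) =
   ev (b *m T) (bas R c) *: bas R d - b 0 d *: (T *m bas R c)
   - ev (a *m T) (bas R c) *: (T *m bas R d) + a 0 d *: (T *m T *m bas R c).
  rewrite !evM -mulmxA.
  pose x := T *m bas R c; have Tx e : T e c = x e 0 by rewrite /x mul_bas mxE.
  rewrite -/x -[T *m x]mul_sum_bas -[X in b 0 d *: X](sum_bas x) -!sum_ev.
  rewrite !scaler_suml !scaler_sumr -!sumrB -big_split /=; apply: eq_bigr => e _.
  rewrite Zl Tx; apply/colP => i; rewrite !entE; ring.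
have e2 : \sum_e T e d *: (Z c e *m l) =
   b 0 c *: (T *m bas R d) - ev (b *m T) (bas R d) *: bas R c
   - a 0 c *: (T *m T *m bas R d) + ev (a *m T) (bas R d) *: (T *m bas R c).
  rewrite !evM -mulmxA.
  pose x := T *m bas R d; have Tx e : T e d = x e 0 by rewrite /x mul_bas mxE.
  rewrite -/x -[T *m x]mul_sum_bas -[X in b 0 c *: X](sum_bas x) -!sum_ev.
  rewrite !scaler_suml !scaler_sumr -!sumrB -big_split /=; apply: eq_bigr => e _.
  rewrite Zl Tx; apply/colP => i; rewrite !entE; ring.
have := congr1 (mulmxr l) (shift_T c d); rewrite /= !mulmx_suml.
under eq_bigr do rewrite -scalemxAl; under [X in _ = X]eq_bigr do rewrite -scalemxAl.
rewrite e1 e2 => /colP e; apply/colP => i; move: (e i).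
by rewrite !evE !ev_bas !entE; lra.
Qed.

Lemma symmetrised_eq0 (u v : 'cV[R]_n) : v != 0 -> u *m v^T + v *m u^T = 0 -> u = 0.
Proof.
move=> v0 h; have [i vi] := col_neq0 v0.
have k j : u j 0 * v i 0 + v j 0 * u i 0 = 0.
  by move/matrixP/(_ j i): h; rewrite !mxE !big_ord1 !mxE.
have ui : u i 0 = 0 by apply: (mulIf vi); have := k i; lra.
by apply/colP => j; rewrite mxE; apply: (mulIf vi); have := k j; rewrite ui; lra.
Qed.

(** The hypothesis is the covariant derivative of T^2 = p T + q, the derivative of T being
    [symprod G l (bas R c)]. Completing the square with E = T - p / 2 absorbs the last term and
    changes Q into Q + (p / 2) P. *)
Lemma span_of_quadratic (p : R) (P Q : 'rV[R]_n) :
  (forall c, T *m symprod G l (bas R c) + symprod G l (bas R c) *m T =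
     P 0 c *: T + (Q 0 c)%:M + p *: symprod G l (bas R c)) ->
  in_span G T a.
Proof.
move=> HD.
have scal_span c : T = c%:M -> in_span G T a.
  by move=> ->; exists c, 0; rewrite scale0r addr0.
have Zl0_span : (forall c d, Z c d *m l = 0) -> in_span G T a.
  move=> Z0; apply: (@span_of_commutator _ _ n2 _ Gu _ _ b) => // x y.
  move: x; apply: lin_bas => [k x x'|c].
    by rewrite !mulmxDr -!scalemxAr !evE; apply/colP=> i; rewrite !entE; ring.
  move: y; apply: lin_bas => [k x x'|d].
    by rewrite !mulmxDr -!scalemxAr !evE; apply/colP=> i; rewrite !entE; ring.
  by rewrite !ev_bas -(Z0 c d) Zl.
have entS (c : R) i j : (c%:M : 'M[R]_n) i j = c * (i == j)%:R.
  by rewrite mxE mulr_natr.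
pose E := T - (p / 2)%:M.
have [||[c Ec]|[l0|[nu [f Ef]]]] := @trace_free_part_rank1 _ _ n2 _ Gu Gs E l P
   (Q + (p / 2) *: P).
- exact: selfadjB.
- move=> z; apply/eqP; rewrite -subr_eq0; apply/eqP; move: z; apply: lin_bas => [k x y|c].
    have -> : symprod G l (k *: x + y) = k *: symprod G l x + symprod G l y.
      rewrite /symprod linearD linearZ /= !mulmxDl !mulmxDr -!scalemxAl -!scalemxAr.
      by apply/matrixP=> i j; rewrite !entE; ring.
    move: (symprod G l x) (symprod G l y) => Sx Sy.
    clearbody E; rewrite mulmxDr mulmxDl -scalemxAr -scalemxAl !evE.
    by apply/matrixP=> i j; rewrite !entE !entS; ring.
  have := HD c; rewrite /E !evE !ev_bas mulmxBl mulmxBr mul_scalar_mx mul_mx_scalar.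
  move=> /matrixP e; apply/matrixP => i j; move: (e i j).
  by rewrite !entE !entS; lra.
- by apply: (@scal_span (c + p / 2)); rewrite raddfD /= -Ec /E subrK.
- by apply: Zl0_span => c d; rewrite l0 mulmx0.
have TE : T = (nu + p / 2)%:M + f *: (l *m l^T *m G).
  by rewrite raddfD /= addrAC -Ef /E subrK.
have [f0|f0] := eqVneq f 0.
  by apply: (@scal_span (nu + p / 2)); rewrite TE f0 scale0r addr0.
have [l0|l0] := eqVneq l 0; first by apply: Zl0_span => c d; rewrite l0 mulmx0.
apply: Zl0_span => c d; apply: (symmetrised_eq0 l0).
(* Z commutes with the rank one part l l^T G; as Z is skew for G, this says that the symmetric
   product of Z l and l is zero. *)
have := ZT c d; rewrite TE mulmxDl mulmxDr mul_mx_scalar mul_scalar_mx => /addrI.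
rewrite -scalemxAr -scalemxAl => /(scalerI f0) e.
have {}e : Z c d *m l *m l^T *m G = - (l *m (Z c d *m l)^T) *m G.
  by rewrite trmx_mul mulNmx -!mulmxA Zanti !mulmxA in e *; rewrite e !mulmxN opprK !mulmxA.
apply: (can_inj (mulmxK Gu)).
by rewrite mulmxDl e mulNmx addNr mul0mx.
Qed.

End Curvature.

(** * Algebra of nullity vectors and of curvature symmetries *)

Section Nullity.
Variables (R : realFieldType) (n : nat).

(** Once w = c v is known, the hypothesis says that the symmetric product of v with L e_d - c e_d
    vanishes. *)
Lemma scalar_of_nullity (L : 'M[R]_n) (v w : 'cV[R]_n) : v != 0 ->
  (forall d, v *m (L *m bas R d)^T + (L *m bas R d) *m v^T =
     bas R d *m w^T + w *m (bas R d)^T) -> exists c, L = c%:M.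
Proof.
move=> v0 h; have [i vi] := col_neq0 v0.
have H a b d : v a 0 * L b d + L a d * v b 0 = (a == d)%:R * w b 0 + w a 0 * (b == d)%:R.
  have /matrixP/(_ a b) := h d.
  by rewrite !mul_bas /bas !mxE !big_ord1 !mxE !eqxx !andbT.
have wv : w = (w i 0 / v i 0) *: v.
  apply/colP => j; rewrite mxE; have [->|ji] := eqVneq j i; first by rewrite divfK.
  have := H i i j; have := H i j j; have := H j j j.
  rewrite !eqxx [i == j]eq_sym (negPf ji) /= => e1 e2 e3.
  (* Evaluate the hypothesis for d = j twice on the covector with entry v_i at j and - v_j at i: it
     kills v, hence the left side, and the right side is twice the claimed product. *)
  have : v i 0 * (v i 0 * w j 0 - v j 0 * w i 0) = 0.
    have -> : v i 0 * (v i 0 * w j 0 - v j 0 * w i 0) =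
      2^-1 * (v i 0 * v i 0 * (1 * w j 0 + w j 0 * 1)
       - 2 * v i 0 * v j 0 * (0 * w j 0 + w i 0 * 1)
       + v j 0 * v j 0 * (0 * w i 0 + w i 0 * 0)) by field.
    by rewrite -e1 -e2 -e3; field.
  move=> /eqP; rewrite mulf_eq0 (negPf vi) subr_eq0 /= => /eqP e.
  by rewrite mulrAC [w i 0 * _]mulrC -e mulrAC mulfV // mul1r.
pose c := w i 0 / v i 0; exists c.
apply: mulmx_ext => x; apply/eqP; rewrite -subr_eq0; apply/eqP; move: x.
apply: lin_bas => [k x y|d].
  by rewrite !mulmxDr -!scalemxAr; apply/colP=> j; rewrite !entE; ring.
apply: (symmetrised_eq0 v0); rewrite mul_scalar_mx.
apply/matrixP=> a b; have := H a b d.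
have wa j : w j 0 = c * v j 0 by rewrite wv entE.
rewrite mul_bas /bas !wa !mxE !big_ord1 !mxE !eqxx !andbT; lra.
Qed.

(** The octahedron argument: four Bianchi identities, one for each index in the first slot, combined
    by the two antisymmetries. *)
Lemma curvature_pair_sym (I : Type) (F : I -> I -> I -> I -> R) :
  (forall a b c d, F a b c d = - F b a c d) ->
  (forall a b c d, F a b c d = - F a b d c) ->
  (forall a b c d, F a b c d + F a c d b + F a d b c = 0) ->
  forall a b c d, F a b c d = F c d a b.
Proof.
move=> h1 h2 h3 a b c d.
have := h3 a b c d; have := h3 b c d a; have := h3 c d a b; have := h3 d a b c.
have := h1 b a c d; have := h1 d c a b; have := h1 c a b d; have := h2 a c b d.
have := h1 d a b c; have := h1 c b d a; have := h1 d b c a; have := h2 b d c a; lra.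
Qed.

End Nullity.

(** * Smooth functions *)

Local Open Scope classical_set_scope.
Local Open Scope ring_scope.

(** The first-order remainder at x involves only values near x, so the differential of f serves for
    g. *)
Lemma near_eq_differentiable (R : numFieldType) (V W : normedModType R)
    (f g : V -> W) (x : V) :
  {near x, f =1 g} -> differentiable f x -> differentiable g x.
Proof.
move=> fg df; have gx : f x = g x := nbhs_singleton fg.
have e : g \o shift x = cst (g x) + 'd f x +o_ 0 id.
  have [_ /eqaddoP H] := (diff_locallyP x f).1 df.
  apply/eqaddoP => eps eps0; have {}H := H eps eps0.
  have fg0 : \forall y \near (0 : V), f (y + x) = g (y + x).
    have : \forall y \near x, f y = g y by [].
    by rewrite (near_shift 0 x); apply: filterS => y /=; rewrite subr0.
  near=> y.
  have -> : (g \o shift x - (cst (g x) + 'd f x)) y =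
            (f \o shift x - (cst (f x) + 'd f x)) y.
    rewrite -gx; congr (_ - _) => /=; apply/esym.
    by near: y.
  by near: y.
have dE := diff_unique (diff_continuous df) e.
by apply/diff_locallyP; rewrite dE; split=> //; exact: diff_continuous.
Unshelve. all: by end_near. Qed.

Section Ck.
Variables (R : realType) (n : nat).
Implicit Types (U V : set 'rV[R]_n) (f h : 'rV[R]_n -> R).

Lemma open_near_eq U f h x : open U -> U x -> (forall y, U y -> f y = h y) ->
  {near x, f =1 h}.
Proof. by move=> oU Ux fh; apply: filterS (open_nbhs_nbhs (conj oU Ux)). Qed.

Lemma partial_ext U f h x a : open U -> U x -> (forall y, U y -> f y = h y) ->
  partial a f x = partial a h x.
Proof. by move=> oU Ux fh; apply: near_eq_derive; exact: open_near_eq fh. Qed.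

Lemma Ck_ext k U f h : open U -> (forall x, U x -> f x = h x) ->
  Ck_on k U f -> Ck_on k U h.
Proof.
move=> oU; elim: k f h => [|k IH] f h fh /=.
  move=> cf x Ux; have fhx := open_near_eq oU Ux fh.
  rewrite /prop_for /continuous_at -(fh x Ux); apply: cvg_trans (cf x Ux).
  exact: near_eq_cvg fhx.
move=> [df pf]; split=> [x Ux|a].
  exact: near_eq_differentiable (open_near_eq oU Ux fh) (df x Ux).
by apply: IH (pf a) => x Ux; exact: partial_ext fh.
Qed.

Lemma Ck_subset k U V f : V `<=` U -> Ck_on k U f -> Ck_on k V f.
Proof.
move=> VU; elim: k f => [|k IH] f /=; first by move=> c x /VU; exact: c.
by move=> [df pf]; split=> [x /VU|a]; [exact: df|exact: IH].
Qed.

Lemma CkS k U f : Ck_on k.+1 U f -> Ck_on k U f.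
Proof.
elim: k f => [|k IH] f [df pf].
  by move=> x Ux; apply: differentiable_continuous; exact: df.
by split=> // a; exact: IH.
Qed.

Lemma partial_cst (c : R) a x : partial a (fun _ : 'rV[R]_n => c) x = 0.
Proof. exact: derive_cst. Qed.

Lemma Ck_cst k U (c : R) : Ck_on k U (fun _ => c).
Proof.
elim: k c => [|k IH] c /=; first by move=> x _; exact: cst_continuous.
split=> [x _|a]; first exact: differentiable_cst.
by rewrite (_ : partial a _ = fun=> 0) //; apply/funext => x; exact: partial_cst.
Qed.

Lemma partialD f h a x : differentiable f x -> differentiable h x ->
  partial a (fun y => f y + h y) x = partial a f x + partial a h x.
Proof. by move=> df dh; apply: deriveD; apply: diff_derivable. Qed.

Lemma partialM f h a x : differentiable f x -> differentiable h x ->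
  partial a (fun y => f y * h y) x = f x * partial a h x + h x * partial a f x.
Proof.
by move=> df dh; rewrite /partial (@deriveM _ _ f h) //; apply: diff_derivable.
Qed.

Lemma Ck_add k U f h : open U -> Ck_on k U f -> Ck_on k U h ->
  Ck_on k U (fun x => f x + h x).
Proof.
move=> oU; elim: k f h => [|k IH] f h /=.
  by move=> cf ch x Ux; apply: continuousD; [exact: cf|exact: ch].
move=> [df pf] [dh ph]; split=> [x Ux|a].
  by apply: differentiableD; [exact: df|exact: dh].
apply: Ck_ext (IH _ _ (pf a) (ph a)) => // x Ux.
by rewrite partialD //; [exact: df|exact: dh].
Qed.

Lemma Ck_mul k U f h : open U -> Ck_on k U f -> Ck_on k U h ->
  Ck_on k U (fun x => f x * h x).
Proof.
move=> oU; elim: k f h => [|k IH] f h.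
  by move=> cf ch x Ux; apply: continuousM; [exact: cf|exact: ch].
move=> Cf Ch; have [df pf] := Cf; have [dh ph] := Ch; split=> [x Ux|a].
  by apply: differentiableM; [exact: df|exact: dh].
apply: Ck_ext (Ck_add oU (IH _ _ (CkS Cf) (ph a)) (IH _ _ (CkS Ch) (pf a))) => // x Ux.
by rewrite partialM //; [exact: df|exact: dh].
Qed.

Lemma partialV f a x : f x != 0 -> differentiable f x ->
  partial a (fun y => (f y)^-1) x = - ((f x)^-1 * (f x)^-1) * partial a f x.
Proof.
move=> fx df; rewrite /partial (@deriveV _ _ f) //; last exact: diff_derivable.
by rewrite expr2 invfM.
Qed.

Lemma Ck_inv k U f : open U -> (forall x, U x -> f x != 0) -> Ck_on k U f ->
  Ck_on k U (fun x => (f x)^-1).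
Proof.
move=> oU f0; elim: k => [|k IH] => [cf x Ux|Cf].
  by apply: continuousV; [exact: f0|exact: cf].
have [df pf] := Cf; split=> [x Ux|a].
  by apply: differentiableV; [exact: df|exact: f0].
have i := IH (CkS Cf).
apply: Ck_ext (Ck_mul oU (Ck_mul oU (Ck_cst k U (-1)) (Ck_mul oU i i)) (pf a)) => // x Ux.
by rewrite partialV ?mulN1r //; [exact: f0|exact: df].
Qed.

Lemma smooth_ext U f h : open U -> (forall x, U x -> f x = h x) ->
  smooth_on U f -> smooth_on U h.
Proof. by move=> oU fh sf k; exact: Ck_ext (sf k). Qed.
Lemma smooth_subset U V f : V `<=` U -> smooth_on U f -> smooth_on V f.
Proof. by move=> VU sf k; exact: Ck_subset (sf k). Qed.
Lemma smooth_cst U (c : R) : smooth_on U (fun _ => c).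
Proof. by move=> k; exact: Ck_cst. Qed.
Lemma smooth_add U f h : open U -> smooth_on U f -> smooth_on U h ->
  smooth_on U (fun x => f x + h x).
Proof. by move=> oU sf sh k; exact: Ck_add. Qed.
Lemma smooth_mul U f h : open U -> smooth_on U f -> smooth_on U h ->
  smooth_on U (fun x => f x * h x).
Proof. by move=> oU sf sh k; exact: Ck_mul. Qed.
Lemma smooth_inv U f : open U -> (forall x, U x -> f x != 0) -> smooth_on U f ->
  smooth_on U (fun x => (f x)^-1).
Proof. by move=> oU f0 sf k; exact: Ck_inv. Qed.
Lemma smooth_opp U f : open U -> smooth_on U f -> smooth_on U (fun x => - f x).
Proof.
move=> oU sf; apply: smooth_ext (smooth_mul oU (smooth_cst U (-1)) sf) => // x _.
by rewrite mulN1r.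
Qed.
Lemma smooth_subf U f h : open U -> smooth_on U f -> smooth_on U h ->
  smooth_on U (fun x => f x - h x).
Proof. by move=> oU sf sh; apply: smooth_add => //; exact: smooth_opp. Qed.
Lemma smooth_bigsum U (I : Type) (r : seq I) (P : pred I) (F : I -> 'rV[R]_n -> R) :
  open U -> (forall i, smooth_on U (F i)) ->
  smooth_on U (fun x => \sum_(i <- r | P i) F i x).
Proof.
move=> oU sF; elim: r => [|i r IH].
  by apply: smooth_ext (smooth_cst U 0) => // x _; rewrite big_nil.
have [Pi|Pi] := boolP (P i).
  by apply: smooth_ext (smooth_add oU (sF i) IH) => // x _; rewrite big_cons Pi.
by apply: smooth_ext IH => // x _; rewrite big_cons (negPf Pi).
Qed.
Lemma smooth_bigprod U (I : Type) (r : seq I) (P : pred I) (F : I -> 'rV[R]_n -> R) :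
  open U -> (forall i, smooth_on U (F i)) ->
  smooth_on U (fun x => \prod_(i <- r | P i) F i x).
Proof.
move=> oU sF; elim: r => [|i r IH].
  by apply: smooth_ext (smooth_cst U 1) => // x _; rewrite big_nil.
have [Pi|Pi] := boolP (P i).
  by apply: smooth_ext (smooth_mul oU (sF i) IH) => // x _; rewrite big_cons Pi.
by apply: smooth_ext IH => // x _; rewrite big_cons (negPf Pi).
Qed.
Lemma smooth_diff U f x : smooth_on U f -> U x -> differentiable f x.
Proof. by move=> sf; have [df _] := sf 1%N; exact: df. Qed.
Lemma smooth_cont U f x : smooth_on U f -> U x -> {for x, continuous f}.
Proof. by move=> sf; exact: sf 0%N x. Qed.
Lemma smooth_partial U f a : smooth_on U f -> smooth_on U (partial a f).
Proof. by move=> sf k; have [_] := sf k.+1; apply. Qed.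

End Ck.

Section Lines.
Variables (R : realType) (V : normedModType R).
Implicit Types (f : V -> R) (x v : V).

Lemma is_derive_line f x v t : derivable f (x + t *: v) v ->
  is_derive t (1 : R) (fun s => f (x + s *: v)) ('D_v f (x + t *: v)).
Proof.
move=> df.
have e : (fun h : R => h^-1 *: (((fun s => f (x + s *: v)) \o shift t) (h *: 1) - f (x + t *: v)))
       = (fun h : R => h^-1 *: ((f \o shift (x + t *: v)) (h *: v) - f (x + t *: v))).
  apply/funext => h /=; rewrite -[h *: 1]/(h * 1) mulr1 scalerDl.
  by rewrite addrCA.
by split; rewrite /derivable /derive e.
Qed.

Lemma mean_value_line f x v h : 0 < h ->
  (forall t, 0 <= t <= h -> derivable f (x + t *: v) v) ->
  exists2 t, 0 < t < h & f (x + h *: v) - f x = h * 'D_v f (x + t *: v).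
Proof.
move=> h0 df.
have D t : 0 <= t <= h -> is_derive t (1 : R) (fun s => f (x + s *: v)) ('D_v f (x + t *: v)).
  by move=> /df; exact: is_derive_line.
have [t|/=|t] := @MVT R (fun s => f (x + s *: v)) (fun t => 'D_v f (x + t *: v)) 0 h h0.
- by rewrite in_itv /= => /andP[/ltW t0 /ltW th]; apply: D; rewrite t0 th.
- apply: derivable_within_continuous => t; rewrite in_itv /= => th.
  by case: (D t th).
- rewrite in_itv /= scale0r addr0 subr0 => th e; exists t => //.
  by rewrite e mulrC.
Qed.

End Lines.

Lemma third_dist_absurd (R : realFieldType) (A B P : R) :
  0 < `|A - B| -> `|A - P| < `|A - B| / 3 -> `|B - P| < `|A - B| / 3 -> False.
Proof.
have := ler_distD P A B; rewrite (distrC P B).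
by move: (`|A - B|) (`|A - P|) (`|B - P|) => u v w; lra.
Qed.

(** * Symmetry of second partial derivatives *)

Section Schwarz.
Variables (R : realType) (n : nat).
Implicit Types (U : set 'rV[R]_n) (f : 'rV[R]_n -> R) (x : 'rV[R]_n).

Let e (a : 'I_n) : 'rV[R]_n := delta_mx 0 a.

(** The mean value theorem twice: along e_a for the increment [psi] in direction e_b, then along e_b
    for the partial derivative of f. *)
Lemma second_difference f U x a b h : 0 < h -> Ck_on 2 U f ->
  (forall s t, 0 <= s <= h -> 0 <= t <= h -> U (x + s *: e a + t *: e b)) ->
  exists s t, [/\ 0 <= s <= h, 0 <= t <= h &
   f (x + h *: e a + h *: e b) - f (x + h *: e a) - f (x + h *: e b) + f x
   = h * h * partial b (partial a f) (x + s *: e a + t *: e b)].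
Proof.
move=> h0 [df pf] HU.
have hh : 0 <= h <= h by rewrite (ltW h0) lexx.
have z0 : 0 <= (0 : R) <= h by rewrite lexx ltW.
have dU y : U y -> derivable f y (e a) by move=> /df; exact: diff_derivable.
pose psi y := f (y + h *: e b) - f y.
have psiE : psi = (fun z => f (z + h *: e b)) - f by [].
have dshift y : U (y + h *: e b) -> derivable (fun z => f (z + h *: e b)) y (e a).
  move=> Uy; have d : differentiable f (y + h *: e b) by exact: df.
  have : derivable f (y + h *: e b) (e a) by exact: diff_derivable.
  rewrite /derivable (_ : (fun k : R => _) = (fun k : R => k^-1 *:
     (((fun z => f (z + h *: e b)) \o shift y) (k *: e a) - f (y + h *: e b)))) //.
  by apply/funext => k /=; rewrite addrA.
have Dshift y : 'D_(e a) (fun z => f (z + h *: e b)) y = 'D_(e a) f (y + h *: e b).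
  rewrite /derive; have -> // : (fun k : R => k^-1 *:
     (((fun z => f (z + h *: e b)) \o shift y) (k *: e a) - f (y + h *: e b)))
    = (fun k : R => k^-1 *: ((f \o shift (y + h *: e b)) (k *: e a) - f (y + h *: e b))).
  by apply/funext => k /=; rewrite addrA.
have [t th|s sh es] := @mean_value_line R _ psi x (e a) h h0.
  rewrite psiE; apply: derivableB; first by apply: dshift; apply: HU.
  by apply: dU; rewrite -[_ + _]addr0 -(scale0r (e b)); exact: HU.
have {}sh : 0 <= s <= h by case/andP: sh => /ltW -> /ltW ->.
have [t th|t th et] := @mean_value_line R _ (partial a f) (x + s *: e a) (e b) h h0.
  by apply: diff_derivable; have [dpf _] := pf a; apply: dpf; exact: HU.
have {}th : 0 <= t <= h by case/andP: th => /ltW -> /ltW ->.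
exists s, t; split=> //.
have -> : f (x + h *: e a + h *: e b) - f (x + h *: e a) - f (x + h *: e b) + f x
   = psi (x + h *: e a) - psi x by rewrite /psi; ring.
rewrite es -mulrA; congr (_ * _); rewrite -[RHS]et.
rewrite psiE deriveB ?Dshift //; first by apply: dshift; exact: HU.
by apply: dU; rewrite -[_ + _]addr0 -(scale0r (e b)); exact: HU.
Qed.

(** The second difference over a square does not depend on the order of a and b, so the two mixed
    derivatives share a value at points of each small square. Were they distinct at x, continuity
    would keep them within a third of the gap of their values at x, hence apart. *)
Lemma partialC f U x a b : open U -> U x -> Ck_on 2 U f ->
  partial a (partial b f) x = partial b (partial a f) x.
Proof.
move=> oU Ux Cf; apply/eqP; rewrite -subr_eq0; apply/negPn/negP => d0.
set A := partial a _ _ in d0; set B := partial b _ _ in d0.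
pose eps := `|A - B| / 3; have eps0 : 0 < eps by rewrite divr_gt0 // normr_gt0.
have [_ pf] := Cf; have [_ pa] := pf a; have [_ pb] := pf b.
have cA : \forall y \near x, `|A - partial a (partial b f) y| < eps.
  by move/cvgrPdist_lt: (pb a x Ux) => /(_ eps eps0).
have cB : \forall y \near x, `|B - partial b (partial a f) y| < eps.
  by move/cvgrPdist_lt: (pa b x Ux) => /(_ eps eps0).
have nU : \forall y \near x, U y by exact: open_nbhs_nbhs.
have : \forall y \near x, [/\ U y, `|A - partial a (partial b f) y| < eps &
   `|B - partial b (partial a f) y| < eps].
  by apply: filterS3 nU cA cB.
move=> /nbhs_ballP[r /= r0 Hr].
pose c := `|e a| + `|e b| + 1; have c0 : 0 < c by rewrite /c ltr_wpDl ?addr_ge0.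
(* The displacement within the square has norm at most h (|e_a| + |e_b|) < h c = r / 2; the summand
   1 makes c positive. *)
pose h := r / (2 * c); have h0 : 0 < h by rewrite divr_gt0 // mulr_gt0.
have Hin s t : 0 <= s <= h -> 0 <= t <= h ->
   ball x r (x + s *: e a + t *: e b).
  move=> /andP[s0 sh] /andP[t0 th]; rewrite -ball_normE /=.
  rewrite opprD addrA opprD addrA subrr sub0r.
  apply: le_lt_trans (ler_normD _ _) _; rewrite !normrN !normrZ !ger0_norm //.
  have : h * c < r.
    by rewrite /h invfM mulrA divfK ?gt_eqF // ltr_pdivrMr // mulr_natr mulr2n ltrDl.
  apply: le_lt_trans; rewrite /c !mulrDr mulr1.
  apply: (@le_trans _ _ (h * `|e a| + h * `|e b|)); last by rewrite lerDl ltW.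
  by apply: lerD; apply: ler_wpM2r.
have [s [t [sh th E1]]] : exists s t, [/\ 0 <= s <= h, 0 <= t <= h &
   f (x + h *: e a + h *: e b) - f (x + h *: e a) - f (x + h *: e b) + f x
   = h * h * partial b (partial a f) (x + s *: e a + t *: e b)].
  apply: second_difference Cf _ => // s t sh th.
  by have [] := Hr _ (Hin s t sh th).
have [s' [t' [sh' th' E2]]] : exists s t, [/\ 0 <= s <= h, 0 <= t <= h &
   f (x + h *: e b + h *: e a) - f (x + h *: e b) - f (x + h *: e a) + f x
   = h * h * partial a (partial b f) (x + s *: e b + t *: e a)].
  apply: second_difference Cf _ => // s' t' sh' th'.
  by rewrite addrAC; have [] := Hr _ (Hin t' s' th' sh').
have E : partial b (partial a f) (x + s *: e a + t *: e b) =
         partial a (partial b f) (x + s' *: e b + t' *: e a).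
  apply: (@mulfI _ (h * h)); first by rewrite mulf_neq0 // gt_eqF.
  apply: etrans (esym E1) (etrans _ E2).
  have <- : x + h *: e a + h *: e b = x + h *: e b + h *: e a by rewrite addrAC.
  by move: (f _) (f _) (f _) (f _) => *; ring.
have [_ _ k1] := Hr _ (Hin s t sh th).
have [_ k2 _] := Hr _ (Hin t' s' th' sh').
rewrite addrAC -E in k2.
apply: (third_dist_absurd _ k2 k1); by rewrite normr_gt0.
Qed.

End Schwarz.

(** * Chain rule and vanishing derivatives *)

Section Chain.
Variables (R : realType) (n : nat).

Lemma derive_partials (F : 'rV[R]_n -> R) z v : differentiable F z ->
  'D_v F z = \sum_a v 0 a * partial a F z.
Proof.
move=> dF; rewrite deriveE // {1}[v]row_sum_delta linear_sum.
by apply: eq_bigr => a _; rewrite linearZ /= /partial deriveE.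
Qed.

Lemma differentiable_rV m (phi : 'rV[R]_n -> 'rV[R]_m) x :
  (forall a, differentiable (fun y => phi y 0 a) x) -> differentiable phi x.
Proof.
move=> dphi.
have -> : phi = \sum_(a < m) (fun y => phi y 0 a *: (delta_mx 0 a : 'rV[R]_m)).
  by apply/funext => y; rewrite {1}[phi y]row_sum_delta fct_sumE.
by apply: differentiable_sum => a; exact: differentiableZl.
Qed.

Lemma partial_chain (F : 'rV[R]_n -> R) (phi : 'rV[R]_n -> 'rV[R]_n) x b :
  (forall a, differentiable (fun y => phi y 0 a) x) -> differentiable F (phi x) ->
  partial b (fun y => F (phi y)) x =
  \sum_a partial a F (phi x) * partial b (fun y => phi y 0 a) x.
Proof.
move=> dphi dF; have dp := differentiable_rV dphi.
rewrite /partial deriveE; last exact: (@differentiable_comp _ _ _ _ phi F).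
rewrite (@diff_comp _ _ _ _ phi F) //= -!deriveE // derive_partials //.
apply: eq_bigr => a _; rewrite mulrC /partial derive_mx ?mxE //.
exact: diff_derivable.
Qed.

Lemma locally_constant (F : 'rV[R]_n -> R) x r :
  (forall z, ball x r z -> differentiable F z /\ forall a, partial a F z = 0) ->
  forall y, ball x r y -> F y = F x.
Proof.
move=> H y; rewrite -ball_normE /= => xy.
have Hz t : 0 <= t <= 1 -> ball x r (x + t *: (y - x)).
  move=> /andP[t0 t1]; rewrite -ball_normE /=.
  rewrite opprD addrA subrr sub0r normrN normrZ ger0_norm //.
  apply: le_lt_trans xy; rewrite distrC.
  by rewrite -[X in _ <= X]mul1r; apply: ler_wpM2r.
have [t /Hz /H [dF _]|t th e] := @mean_value_line R _ F x (y - x) 1 ltr01.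
  exact: diff_derivable.
have /Hz/H [dF p0] : 0 <= t <= 1 by case/andP: th => /ltW -> /ltW ->.
move: e; rewrite scale1r [x + (y - x)]addrC subrK derive_partials // big1 ?mulr0.
  by move=> /eqP; rewrite subr_eq0 => /eqP.
by move=> a _; rewrite p0 mulr0.
Qed.

End Chain.

(* Locked: deciding that two distinct derivatives are not convertible by unfolding
   limits does not terminate in practice. *)
HB.lock Definition pdm (R : realType) (n p q : nat) (a : 'I_n)
    (F : 'rV[R]_n -> 'M[R]_(p, q)) (x : 'rV[R]_n) : 'M[R]_(p, q) :=
  \matrix_(i, j) partial a (fun y => F y i j) x.

Section MatrixValued.
Variables (R : realType) (n : nat) (U : set 'rV[R]_n).
Hypothesis oU : open U.

Lemma pdmE p q a (F : 'rV[R]_n -> 'M[R]_(p, q)) x i j :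
  pdm a F x i j = partial a (fun y => F y i j) x.
Proof. by rewrite pdm.unlock mxE. Qed.

Definition smx p q (F : 'rV[R]_n -> 'M[R]_(p, q)) : Prop :=
  forall i j, smooth_on U (fun x => F x i j).

Lemma smx_ext p q (F H : 'rV[R]_n -> 'M[R]_(p, q)) :
  (forall x, U x -> F x = H x) -> smx F -> smx H.
Proof. by move=> FH sF i j; apply: smooth_ext (sF i j) => // x Ux; rewrite FH. Qed.

Lemma smx_cst p q (A : 'M[R]_(p, q)) : smx (fun _ => A).
Proof. by move=> i j; exact: smooth_cst. Qed.

Lemma smx_add p q (F H : 'rV[R]_n -> 'M[R]_(p, q)) :
  smx F -> smx H -> smx (fun x => F x + H x).
Proof.
move=> sF sH i j; apply: smooth_ext (smooth_add oU (sF i j) (sH i j)) => // x _.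
by rewrite mxE.
Qed.

Lemma smx_scale p q (f : 'rV[R]_n -> R) (F : 'rV[R]_n -> 'M[R]_(p, q)) :
  smooth_on U f -> smx F -> smx (fun x => f x *: F x).
Proof.
move=> sf sF i j; apply: smooth_ext (smooth_mul oU sf (sF i j)) => // x _.
by rewrite mxE.
Qed.

Lemma smx_opp p q (F : 'rV[R]_n -> 'M[R]_(p, q)) : smx F -> smx (fun x => - F x).
Proof.
by move=> sF i j; apply: smooth_ext (smooth_opp oU (sF i j)) => // x _; rewrite mxE.
Qed.

Lemma smx_tr p q (F : 'rV[R]_n -> 'M[R]_(p, q)) : smx F -> smx (fun x => (F x)^T).
Proof. by move=> sF i j; apply: smooth_ext (sF j i) => // x _; rewrite mxE. Qed.

Lemma smx_mul p q r (F : 'rV[R]_n -> 'M[R]_(p, q)) (H : 'rV[R]_n -> 'M[R]_(q, r)) :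
  smx F -> smx H -> smx (fun x => F x *m H x).
Proof.
move=> sF sH i j.
apply: (@smooth_ext _ _ _ (fun x => \sum_k F x i k * H x k j)) => // [x _|].
  by rewrite mxE.
by apply: smooth_bigsum => // k; exact: smooth_mul.
Qed.

Lemma smx_scalar p (f : 'rV[R]_n -> R) : smooth_on U f -> smx (fun x => (f x)%:M : 'M[R]_p).
Proof.
move=> sf; apply: smx_ext (smx_scale sf (smx_cst 1%:M)) => x _.
by rewrite scalemx1.
Qed.

Lemma smooth_trace p (F : 'rV[R]_n -> 'M[R]_p) : smx F -> smooth_on U (fun x => \tr (F x)).
Proof. by move=> sF; apply: smooth_bigsum => // i; exact: sF. Qed.

Lemma smooth_det p (F : 'rV[R]_n -> 'M[R]_p) : smx F -> smooth_on U (fun x => \det (F x)).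
Proof.
move=> sF; apply: smooth_bigsum => // s; apply: smooth_mul => //.
  exact: smooth_cst.
by apply: smooth_bigprod => // i; exact: sF.
Qed.

Lemma smx_inv p (F : 'rV[R]_n -> 'M[R]_p) : (forall x, U x -> F x \in unitmx) ->
  smx F -> smx (fun x => invmx (F x)).
Proof.
move=> uF sF; apply: (@smx_ext _ _ (fun x => (\det (F x))^-1 *: \adj (F x))).
  by move=> x Ux; rewrite /invmx uF.
apply: smx_scale.
  apply: smooth_inv => //; last exact: smooth_det.
  by move=> x /uF; rewrite unitmxE unitfE.
move=> i j; apply: (@smooth_ext _ _ _ (fun x => cofactor (F x) j i)) => // [x _|].
  by rewrite mxE.
apply: smooth_mul => //; first exact: smooth_cst.
apply: smooth_det => k l; apply: smooth_ext (sF (lift j k) (lift i l)) => // x _.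
by rewrite !mxE.
Qed.

Lemma smx_pdm p q a (F : 'rV[R]_n -> 'M[R]_(p, q)) : smx F -> smx (pdm a F).
Proof.
move=> sF i j; apply: smooth_ext (smooth_partial a (sF i j)) => // x _.
by rewrite pdmE.
Qed.

Variable x : 'rV[R]_n.
Hypothesis Ux : U x.

Lemma pdm_ext p q a (F H : 'rV[R]_n -> 'M[R]_(p, q)) :
  (forall y, U y -> F y = H y) -> pdm a F x = pdm a H x.
Proof.
move=> FH; apply/matrixP=> i j; rewrite !pdmE.
by apply: (partial_ext _ oU) => // y Uy; rewrite FH.
Qed.

Lemma pdm_cst p q a (A : 'M[R]_(p, q)) : pdm a (fun _ => A) x = 0.
Proof. by apply/matrixP=> i j; rewrite pdmE partial_cst mxE. Qed.

Lemma partial_add a (f h : 'rV[R]_n -> R) : smooth_on U f -> smooth_on U h ->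
  partial a (fun y => f y + h y) x = partial a f x + partial a h x.
Proof. by move=> sf sh; apply: partialD; exact: smooth_diff Ux. Qed.

Lemma partial_mul a (f h : 'rV[R]_n -> R) : smooth_on U f -> smooth_on U h ->
  partial a (fun y => f y * h y) x = partial a f x * h x + f x * partial a h x.
Proof.
move=> sf sh; rewrite partialM; [by rewrite addrC mulrC|exact: smooth_diff Ux..].
Qed.

Lemma partial_sum (I : Type) (r : seq I) a (F : I -> 'rV[R]_n -> R) :
  (forall i, smooth_on U (F i)) ->
  partial a (fun y => \sum_(i <- r) F i y) x = \sum_(i <- r) partial a (F i) x.
Proof.
move=> sF; elim: r => [|i r IH].
  rewrite big_nil -[RHS](partial_cst 0 a x); apply: (partial_ext _ oU) => // y _.
  by rewrite big_nil.
rewrite big_cons -IH -partial_add //; last by apply: smooth_bigsum.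
by apply: (partial_ext _ oU) => // y _; rewrite big_cons.
Qed.

Lemma pdmD p q a (F H : 'rV[R]_n -> 'M[R]_(p, q)) : smx F -> smx H ->
  pdm a (fun y => F y + H y) x = pdm a F x + pdm a H x.
Proof.
move=> sF sH; apply/matrixP=> i j; rewrite [RHS]mxE !pdmE -partial_add //.
by apply: (partial_ext _ oU) => // y _; rewrite mxE.
Qed.

Lemma pdmZ p q a (f : 'rV[R]_n -> R) (F : 'rV[R]_n -> 'M[R]_(p, q)) :
  smooth_on U f -> smx F ->
  pdm a (fun y => f y *: F y) x = partial a f x *: F x + f x *: pdm a F x.
Proof.
move=> sf sF; apply/matrixP=> i j; rewrite [RHS]mxE [X in X + _]mxE [X in _ + X]mxE !pdmE -partial_mul //.
by apply: (partial_ext _ oU) => // y _; rewrite mxE.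
Qed.

Lemma pdmN p q a (F : 'rV[R]_n -> 'M[R]_(p, q)) : smx F ->
  pdm a (fun y => - F y) x = - pdm a F x.
Proof.
move=> sF; rewrite -scaleN1r -[RHS]add0r -[X in X + _](scale0r (F x)).
rewrite -(partial_cst (-1) a x) -pdmZ //; last exact: smooth_cst.
by apply: pdm_ext => y _; rewrite scaleN1r.
Qed.

Lemma pdmB p q a (F H : 'rV[R]_n -> 'M[R]_(p, q)) : smx F -> smx H ->
  pdm a (fun y => F y - H y) x = pdm a F x - pdm a H x.
Proof. by move=> sF sH; rewrite pdmD ?pdmN //; exact: smx_opp. Qed.

Lemma pdmT p q a (F : 'rV[R]_n -> 'M[R]_(p, q)) :
  pdm a (fun y => (F y)^T) x = (pdm a F x)^T.
Proof.
apply/matrixP=> i j; rewrite [RHS]mxE !pdmE; apply: (partial_ext _ oU) => // y _.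
by rewrite mxE.
Qed.

Lemma pdmM p q r a (F : 'rV[R]_n -> 'M[R]_(p, q)) (H : 'rV[R]_n -> 'M[R]_(q, r)) :
  smx F -> smx H ->
  pdm a (fun y => F y *m H y) x = pdm a F x *m H x + F x *m pdm a H x.
Proof.
move=> sF sH; apply/matrixP=> i j; rewrite pdmE !mxE.
transitivity (partial a (fun y => \sum_k F y i k * H y k j) x).
  by apply: (partial_ext _ oU) => // y _; rewrite mxE.
rewrite partial_sum; last by move=> k; exact: smooth_mul.
rewrite -big_split; apply: eq_bigr => k _; by rewrite partial_mul // !pdmE.
Qed.

Lemma pdm_scalar p a (f : 'rV[R]_n -> R) : smooth_on U f ->
  pdm a (fun y => (f y)%:M : 'M[R]_p) x = (partial a f x)%:M.
Proof.
move=> sf; rewrite -scalemx1 -[RHS]addr0 -[X in _ + X](scaler0 _ (f x)).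
rewrite -(pdm_cst a 1%:M) -pdmZ //; last exact: smx_cst.
by apply: pdm_ext => y _; rewrite scalemx1.
Qed.

Lemma partial_trace p a (F : 'rV[R]_n -> 'M[R]_p) : smx F ->
  partial a (fun y => \tr (F y)) x = \tr (pdm a F x).
Proof.
move=> sF; rewrite /mxtrace partial_sum; last by move=> i; exact: sF.
by apply: eq_bigr => i _; rewrite pdmE.
Qed.

Lemma pdmC p q a b (F : 'rV[R]_n -> 'M[R]_(p, q)) : smx F ->
  pdm a (pdm b F) x = pdm b (pdm a F) x.
Proof.
move=> sF; apply/matrixP=> i j; rewrite [LHS]pdmE [RHS]pdmE.
have E c d : partial c (fun y => pdm d F y i j) x =
             partial c (partial d (fun y => F y i j)) x.
  by apply: (partial_ext _ oU) => // y _; rewrite pdmE.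
by rewrite !E; apply: partialC oU Ux _; exact: sF.
Qed.

End MatrixValued.

(** * Curvature and the metrisability equation in a chart *)

(* Christoffel symbols of the first kind: entry (a, b) is Gamma_{a, c b} *)
HB.lock Definition Gam1 (R : realType) (n : nat) (G : 'rV[R]_n -> 'M[R]_n)
    (c : 'I_n) (x : 'rV[R]_n) : 'M[R]_n := \matrix_(a, b) (2^-1 *
  (partial c (fun y => G y a b) x + partial b (fun y => G y a c) x
   - partial a (fun y => G y c b) x)).

(* Entry (a, b) is Gamma^a_{cb} *)
HB.lock Definition Gam (R : realType) (n : nat) (G : 'rV[R]_n -> 'M[R]_n)
    (c : 'I_n) (x : 'rV[R]_n) : 'M[R]_n := invmx (G x) *m Gam1 G c x.

(* Entry (a, b) is R^a_{bcd} *)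
HB.lock Definition Om (R : realType) (n : nat) (G : 'rV[R]_n -> 'M[R]_n)
    (c d : 'I_n) (x : 'rV[R]_n) : 'M[R]_n :=
  pdm c (Gam G d) x - pdm d (Gam G c) x
  + (Gam G c x *m Gam G d x - Gam G d x *m Gam G c x).

Section MatrixLinear.
Variables (R : pzRingType) (m n : nat).
Implicit Types A C : 'M[R]_(m, n).
Lemma trD A C : (A + C)^T = A^T + C^T. Proof. exact: linearD. Qed.
Lemma trN A : (- A)^T = - A^T. Proof. exact: linearN. Qed.
Lemma trZ (R' : comPzRingType) c (A : 'M[R']_(m, n)) : (c *: A)^T = c *: A^T.
Proof. exact: linearZ. Qed.
Lemma mxtD (A C : 'M[R]_n) : \tr (A + C) = \tr A + \tr C. Proof. exact: linearD. Qed.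
Lemma mxtN (A : 'M[R]_n) : \tr (- A) = - \tr A. Proof. exact: linearN. Qed.
End MatrixLinear.

Section LocalGeometry.
Variables (R : realType) (n : nat) (U : set 'rV[R]_n).
Hypothesis oU : open U.
Variable G : 'rV[R]_n -> 'M[R]_n.
Hypothesis sG : smx U G.
Hypothesis Gs : forall x, U x -> (G x)^T = G x.
Hypothesis Gu : forall x, U x -> G x \in unitmx.
Implicit Types (x y : 'rV[R]_n) (a b c d : 'I_n).

Local Notation bas := (bas R).

Local Notation Gam1 := (Gam1 G).
Local Notation Gam := (Gam G).
Local Notation Om := (Om G).

Lemma smx_Gam c : smx U (Gam c).
Proof.
rewrite Gam.unlock Gam1.unlock; apply: smx_mul => //; first exact: smx_inv.
move=> a b; pose f x := 2^-1 *
  (partial c (fun y => G y a b) x + partial b (fun y => G y a c) x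
   - partial a (fun y => G y c b) x).
apply: (@smooth_ext _ _ _ f) => // [x _|]; first by rewrite mxE.
apply: smooth_mul => //; first exact: smooth_cst.
by apply: smooth_subf => //; [apply: smooth_add => //|]; exact: smooth_partial.
Qed.

Lemma G_entry_sym x a b : U x -> G x a b = G x b a.
Proof. by move=> /Gs {1}<-; rewrite mxE. Qed.

Lemma mul_G_Gam x c : U x -> G x *m Gam c x = Gam1 c x.
Proof. by move=> Ux; rewrite Gam.unlock mulKVmx // Gu. Qed.

Lemma metric_compat x c : U x ->
  pdm c G x = (Gam c x)^T *m G x + G x *m Gam c x.
Proof.
move=> Ux; rewrite -[X in (Gam c x)^T *m X]Gs // -trmx_mul mul_G_Gam // Gam1.unlock.
have sym a b e : partial e (fun y => G y a b) x = partial e (fun y => G y b a) x.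
  by apply: (partial_ext _ oU) => // y; exact: G_entry_sym.
apply/matrixP => a b; rewrite [LHS]pdmE !mxE (sym b a) (sym c a) (sym c b); lra.
Qed.

Lemma Gam_sym x c d : U x -> Gam c x *m bas d = Gam d x *m bas c.
Proof.
move=> Ux; rewrite Gam.unlock -!mulmxA Gam1.unlock; congr (_ *m _).
have sym a b e : partial e (fun y => G y a b) x = partial e (fun y => G y b a) x.
  by apply: (partial_ext _ oU) => // y; exact: G_entry_sym.
by apply/colP => a; rewrite !mul_bas !mxE (sym c d); ring.
Qed.

Lemma OmC x c d : Om d c x = - Om c d x.
Proof. by rewrite Om.unlock; apply/matrixP => i j; rewrite !entE; ring. Qed.

(** Torsion-freeness [Gam_sym] cancels the quadratic terms directly, and the derivative terms after
    differentiation ([dsym]). *)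
Lemma Om_bianchi x b c d : U x ->
  Om c d x *m bas b + Om d b x *m bas c + Om b c x *m bas d = 0.
Proof.
move=> Ux.
have dsym a e f : pdm a (Gam e) x *m bas f = pdm a (Gam f) x *m bas e.
  have sc e' : smx U (fun _ : 'rV[R]_n => bas e') by exact: smx_cst.
  transitivity (pdm a (fun y => Gam e y *m bas f) x).
    by rewrite (pdmM oU) //; [rewrite pdm_cst mulmx0 addr0|exact: smx_Gam].
  transitivity (pdm a (fun y => Gam f y *m bas e) x).
    by apply: (pdm_ext oU) => // y Uy; exact: Gam_sym.
  by rewrite (pdmM oU) //; [rewrite pdm_cst mulmx0 addr0|exact: smx_Gam].
rewrite Om.unlock !mulmxDl !mulNmx -!mulmxA.
rewrite (dsym c d b) (dsym d c b) (dsym b c d) (Gam_sym d b Ux) (Gam_sym c b Ux) (Gam_sym c d Ux).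
by apply/matrixP => i j; rewrite !entE; ring.
Qed.

(** The Ricci identity for the parallel tensor G: the second partials of G commute, and
    [metric_compat] is substituted for the first ones. *)
Lemma Om_anti x c d : U x -> (Om c d x)^T *m G x = - (G x *m Om c d x).
Proof.
move=> Ux.
have E a e : pdm a (pdm e G) x =
   (pdm a (Gam e) x)^T *m G x + (Gam e x)^T *m pdm a G x
   + (pdm a G x *m Gam e x + G x *m pdm a (Gam e) x).
  have se := smx_Gam e; have st := smx_tr oU se.
  transitivity (pdm a (fun y => (Gam e y)^T *m G y + G y *m Gam e y) x).
    by apply: (pdm_ext oU) => // y Uy; exact: metric_compat.
  by rewrite (pdmD oU) ?(pdmM oU) ?(pdmT oU) //; exact: smx_mul.
have := pdmC oU Ux c d sG; rewrite !E !(metric_compat _ Ux).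
rewrite Om.unlock !trD !trN !trmx_mul.
rewrite ?mulmxDl ?mulmxDr ?mulNmx ?mulmxN !mulmxA.
by move=> /matrixP e; apply/matrixP => i j; move: (e i j); rewrite !entE; lra.
Qed.

Lemma Om_pair x a b c d : U x ->
  (G x *m Om c d x) a b = (G x *m Om a b x) c d.
Proof.
move=> Ux.
apply: (@curvature_pair_sym R 'I_n (fun a b c d => (G x *m Om c d x) a b)).
- move=> {}a {}b {}c {}d; have /matrixP/(_ b a) := Om_anti c d Ux.
  by rewrite -{1}(Gs Ux) -trmx_mul [LHS]mxE entN.
- by move=> {}a {}b {}c {}d; rewrite (OmC _ d c) mulmxN entN.
- move=> {}a {}b {}c {}d.
  have /(congr1 (fun A => (G x *m A) a 0)) := Om_bianchi b c d Ux.
  by rewrite !mulmxDr mulmx0 !mulmxA !mul_bas !entE ![(col _ _) _ _]mxE.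
Qed.

Lemma Om_trace x c d : U x -> \tr (Om c d x) = 0.
Proof.
move=> Ux; have := congr1 (fun A => \tr (invmx (G x) *m A)) (Om_anti c d Ux).
rewrite mulmxN mulKmx ?Gu // mxtN mulmxA mxtrace_mulC mulmxA mulmxV ?Gu //.
by rewrite mul1mx mxtrace_tr => /eqP; rewrite -addr_eq0 -mulr2n mulrn_eq0 /= => /eqP.
Qed.

(** The curvature is trace-free, so tr Gamma is a closed one-form and the connection induced on
    densities is flat. *)
Lemma partial_trace_Gam x c d : U x ->
  partial c (fun y => \tr (Gam d y)) x = partial d (fun y => \tr (Gam c y)) x.
Proof.
move=> Ux; rewrite !(partial_trace oU) //; try exact: smx_Gam.
have := Om_trace c d Ux; rewrite Om.unlock !mxtD !mxtN [\tr (Gam c x *m Gam d x)]mxtrace_mulC.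
lra.
Qed.

End LocalGeometry.

(** * Integrability conditions of the metrisability equation *)

Section Metrisability.
Variables (R : realType) (n : nat) (U : set 'rV[R]_n).
Hypothesis oU : open U.
Variable G : 'rV[R]_n -> 'M[R]_n.
Hypothesis sG : smx U G.
Hypothesis Gs : forall x, U x -> (G x)^T = G x.
Hypothesis Gu : forall x, U x -> G x \in unitmx.
Variables (S : 'rV[R]_n -> 'M[R]_n) (l : 'rV[R]_n -> 'cV[R]_n) (w : R).
Hypothesis sS : smx U S.
Hypothesis sl : smx U l.
Implicit Types (x y : 'rV[R]_n) (a b c d : 'I_n).

Local Notation bas := (bas R).
Local Notation Gam := (Gam G).
Local Notation Om := (Om G).

(* The connection form of the densities of weight w (n + 1) *)
Definition tGam c x : R := w * \tr (Gam c x).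

Hypothesis HS : forall x c, U x -> pdm c S x =
  bas c *m (l x)^T + l x *m (bas c)^T
  - (Gam c x *m S x + S x *m (Gam c x)^T) - tGam c x *: S x.

Let sGam c : smx U (Gam c). Proof. exact: smx_Gam. Qed.

Lemma smooth_tGam c : smooth_on U (tGam c).
Proof.
apply: smooth_mul => //; first exact: smooth_cst.
exact: smooth_trace.
Qed.

Lemma partial_tGam x c d : U x -> partial c (tGam d) x = partial d (tGam c) x.
Proof.
move=> Ux.
have E a e : partial a (tGam e) x = w * partial a (fun y => \tr (Gam e y)) x.
  rewrite [LHS](partial_mul Ux) //; last 2 first.
  - exact: smooth_cst.
  - exact: smooth_trace.
  by rewrite partial_cst mul0r add0r.
by rewrite !E (partial_trace_Gam oU sG Gs Gu c d Ux).
Qed.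

(* nabla_c lambda *)
Definition nabl c x : 'cV[R]_n := pdm c l x + Gam c x *m l x + tGam c x *: l x.

Lemma smx_nabl c : smx U (nabl c).
Proof.
apply: smx_add => //; last by apply: smx_scale => //; exact: smooth_tGam.
apply: smx_add => //; first exact: smx_pdm.
exact: smx_mul.
Qed.

Lemma Gam_symT x c d : U x -> (bas d)^T *m (Gam c x)^T = (bas c)^T *m (Gam d x)^T.
Proof. by move=> Ux; rewrite -!trmx_mul (Gam_sym oU Gs). Qed.

(** The Ricci identity for S, with [HS] substituted into the commuting second partials. The weight
    leaves no curvature term because [tGam] is closed. *)
Lemma commutator_S x c d : U x ->
  Om c d x *m S x + S x *m (Om c d x)^T =
  bas d *m (nabl c x)^T + nabl c x *m (bas d)^T
  - (bas c *m (nabl d x)^T + nabl d x *m (bas c)^T).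
Proof.
move=> Ux.
have E a e : pdm a (pdm e S) x =
   bas e *m (pdm a l x)^T + pdm a l x *m (bas e)^T
   - (pdm a (Gam e) x *m S x + Gam e x *m pdm a S x
      + (pdm a S x *m (Gam e x)^T + S x *m (pdm a (Gam e) x)^T))
   - (partial a (tGam e) x *: S x + tGam e x *: pdm a S x).
  have se := sGam e; have st := smooth_tGam e.
  have seT : smx U (fun y => (Gam e y)^T) by exact: smx_tr.
  have slT : smx U (fun y => (l y)^T) by exact: smx_tr.
  have sb : smx U (fun=> bas e) by exact: smx_cst.
  have sbT : smx U (fun=> (bas e)^T) by exact: smx_cst.
  have m1 : smx U (fun y => bas e *m (l y)^T) by exact: smx_mul.
  have m2 : smx U (fun y => l y *m (bas e)^T) by exact: smx_mul.
  have m3 : smx U (fun y => Gam e y *m S y) by exact: smx_mul.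
  have m4 : smx U (fun y => S y *m (Gam e y)^T) by exact: smx_mul.
  have m5 : smx U (fun y => tGam e y *: S y) by exact: smx_scale.
  have m12 := smx_add oU m1 m2; have m34 := smx_add oU m3 m4.
  have m34n := smx_opp oU m34; have m14 := smx_add oU m12 m34n.
  transitivity (pdm a (fun y => bas e *m (l y)^T + l y *m (bas e)^T
    - (Gam e y *m S y + S y *m (Gam e y)^T) - tGam e y *: S y) x).
    by apply: (pdm_ext oU) => // y Uy; exact: HS.
  rewrite (pdmB oU Ux _ m14 m5) (pdmB oU Ux _ m12 m34) (pdmD oU Ux _ m1 m2).
  rewrite (pdmD oU Ux _ m3 m4) (pdmZ oU Ux _ st sS) (pdmM oU Ux _ sb slT).
  rewrite (pdmM oU Ux _ sl sbT) (pdmM oU Ux _ se sS) (pdmM oU Ux _ sS seT).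
  by rewrite !pdm_cst !(pdmT oU Ux) mul0mx mulmx0 add0r addr0.
have := pdmC oU Ux c d sS; rewrite !E (partial_tGam c d Ux) !(HS _ Ux) /nabl Om.unlock.
rewrite !trD ?trN ?trZ !trmx_mul.
rewrite ?mulmxDl ?mulmxDr ?mulNmx ?mulmxN -?scalemxAl -?scalemxAr.
rewrite ?mulmxDl ?mulmxDr ?mulNmx ?mulmxN -?scalemxAl -?scalemxAr.
rewrite ?scalerDr ?scalerN !mulmxA.
rewrite !(Gam_sym oU Gs d c Ux) -!mulmxA !(Gam_symT d c Ux) !mulmxA.
move=> /matrixP e; apply/matrixP => i j; move: (e i j); rewrite !entE.
lra.
Qed.

(** The Ricci identity for lambda. Christoffel symbols acting on the form index are left out, since
    they cancel in the antisymmetrisation. *)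
Lemma commutator_l x c d : U x ->
  Om c d x *m l x =
  pdm c (nabl d) x + Gam c x *m nabl d x + tGam c x *: nabl d x
  - (pdm d (nabl c) x + Gam d x *m nabl c x + tGam d x *: nabl c x).
Proof.
move=> Ux.
have E a e : pdm a (nabl e) x = pdm a (pdm e l) x
   + (pdm a (Gam e) x *m l x + Gam e x *m pdm a l x)
   + (partial a (tGam e) x *: l x + tGam e x *: pdm a l x).
  have se := sGam e; have st := smooth_tGam e.
  have m1 : smx U (pdm e l) by exact: smx_pdm.
  have m2 : smx U (fun y => Gam e y *m l y) by exact: smx_mul.
  have m3 : smx U (fun y => tGam e y *: l y) by exact: smx_scale.
  have m12 := smx_add oU m1 m2.
  by rewrite (pdmD oU Ux _ m12 m3) (pdmD oU Ux _ m1 m2) (pdmZ oU Ux _ st sl) (pdmM oU Ux _ se sl).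
have := pdmC oU Ux c d sl; rewrite !E (partial_tGam c d Ux) /nabl Om.unlock.
rewrite ?mulmxDl ?mulmxDr ?mulNmx ?mulmxN -?scalemxAl -?scalemxAr.
rewrite ?mulmxDl ?mulmxDr ?mulNmx ?mulmxN -?scalemxAl -?scalemxAr.
rewrite ?scalerDr ?scalerN !mulmxA.
move=> /colP e; apply/colP => i; move: (e i); rewrite !entE.
lra.
Qed.

Variables B cc : 'rV[R]_n -> R.
Hypothesis sB : smooth_on U B.
Hypothesis scc : smooth_on U cc.
Hypothesis HN : forall x c, U x ->
  nabl c x = cc x *: bas c - B x *: (S x *m G x *m bas c).

(* The curvature of [G] minus [B x] times that of constant curvature 1 *)
Definition Zc c d x : 'M[R]_n := Om c d x -
  B x *: (bas c *m (bas d)^T *m G x - bas d *m (bas c)^T *m G x).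

(** Insert [HN] into [commutator_l]. The factor 2 in [2 * B x] has two equal sources: the derivative
    of T and the constant curvature part of [Zc]. *)
Lemma Zc_l x c d : U x ->
  let b := \row_e (partial e cc x + tGam e x * cc x) + (2 * B x) *: ((l x)^T *m G x) in
  Zc c d x *m l x = b 0 c *: bas d - b 0 d *: bas c
   - partial c B x *: (S x *m G x *m bas d) + partial d B x *: (S x *m G x *m bas c).
Proof.
move=> Ux b; rewrite /Zc mulmxBl commutator_l //.
have be e : b 0 e = partial e cc x + tGam e x * cc x + 2 * B x * ev ((l x)^T *m G x) (bas e).
  by rewrite ev_bas /b !entE !mxE.
have E a e : pdm a (nabl e) x = partial a cc x *: bas e
   - (partial a B x *: (S x *m G x *m bas e)
      + B x *: (pdm a S x *m G x *m bas e + S x *m pdm a G x *m bas e)).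
  have sb : smx U (fun=> bas e) by exact: smx_cst.
  have m1 : smx U (fun y => S y *m G y) by exact: smx_mul.
  have m2 : smx U (fun y => S y *m G y *m bas e) by exact: smx_mul.
  have m3 := smx_scale oU sB m2; have m4 := smx_scale oU scc sb.
  transitivity (pdm a (fun y => cc y *: bas e - B y *: (S y *m G y *m bas e)) x).
    by apply: (pdm_ext oU) => // y Uy; exact: HN.
  rewrite (pdmB oU Ux _ m4 m3) (pdmZ oU Ux _ scc sb) (pdmZ oU Ux _ sB m2).
  rewrite (pdmM oU Ux _ m1 sb) (pdmM oU Ux _ sS sG) pdm_cst.
  by rewrite scaler0 mulmx0 !addr0 mulmxDl.
rewrite !E !be !(HN _ Ux) !(HS _ Ux) !(metric_compat oU Gs Gu _ Ux).
rewrite ?mulmxDl ?mulmxDr ?mulNmx ?mulmxN -?scalemxAl -?scalemxAr.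
rewrite ?mulmxDl ?mulmxDr ?mulNmx ?mulmxN -?scalemxAl -?scalemxAr.
rewrite ?mulmxDl ?mulmxDr ?mulNmx ?mulmxN -?scalemxAl -?scalemxAr.
rewrite ?scalerDr ?scalerN !mulmxA.
have H1 (e f : 'I_n) : bas e *m (l x)^T *m G x *m bas f = ev ((l x)^T *m G x) (bas f) *: bas e.
  by have := mulcr (bas e) ((l x)^T *m G x) (bas f); rewrite !mulmxA.
have H2 (e f : 'I_n) : bas e *m (bas f)^T *m G x *m l x = ev ((l x)^T *m G x) (bas f) *: bas e.
  have -> : ev ((l x)^T *m G x) (bas f) = ev ((bas f)^T *m G x) (l x).
    by rewrite !ev_bil bil_sym // Gs.
  by have := mulcr (bas e) ((bas f)^T *m G x) (l x); rewrite !mulmxA.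
have H3 (e f : 'I_n) : l x *m (bas e)^T *m G x *m bas f = G x e f *: l x.
  by have := mulcr (l x) ((bas e)^T *m G x) (bas f); rewrite ev_bil bil_bas !mulmxA.
have H4 A : A *m Gam c x *m bas d = A *m Gam d x *m bas c :> 'cV_n.
  by rewrite -!mulmxA (Gam_sym oU Gs).
rewrite !H1 !H2 !H3 !H4 (G_entry_sym Gs d c Ux) (Gam_sym oU Gs c d Ux).
apply/colP => i; rewrite !entE; ring.
Qed.

End Metrisability.

(** * Closed formulas for the two coefficients *)

Section Coefficients.
Variables (R : realFieldType) (n : nat).
Implicit Types (T : 'M[R]_n) (D : 'rV[R]_n) (V : 'cV[R]_n).

(* For T = nu + e V D: D^T spans a complement of ker D, and nu is read off from the
   trace of T times the Euclidean projection onto ker D. *)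
Definition nu_of T D : R :=
  (\tr T - ((D *m D^T) 0 0)^-1 * (D *m T *m D^T) 0 0) * (n%:R - 1)^-1.

(** The denominator is a product of Euclidean squares, nonzero even where V is null for the metric
    and [D *m V] vanishes. *)
Definition eps_of T D V : R :=
  ((V^T *m T *m D^T) 0 0 - nu_of T D * (V^T *m D^T) 0 0) *
  ((V^T *m V) 0 0 * (D *m D^T) 0 0)^-1.

Lemma row_sqnorm_neq0 D : D != 0 -> (D *m D^T) 0 0 != 0.
Proof.
apply: contraNneq => h; apply/eqP/rowP => i; rewrite mxE.
move: h; rewrite mxE => /eqP; rewrite psumr_eq0; last first.
  by move=> j _; rewrite mxE -expr2 sqr_ge0.
by move=> /allP/(_ i (mem_index_enum _)); rewrite mxE mulf_eq0 orbb => /eqP.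
Qed.

Lemma col_sqnorm_neq0 V : V != 0 -> (V^T *m V) 0 0 != 0.
Proof.
move=> V0; have := @row_sqnorm_neq0 V^T; rewrite trmxK; apply.
by apply: contraNneq V0 => h; rewrite -[V]trmxK h trmx0.
Qed.

(** Besides smoothness of the coefficients, this yields their transformation law: any decomposition
    found in a chart must be the one computed by the formulas. *)
Lemma coefficients_unique T D V nu e : (1 < n)%N -> D != 0 -> V != 0 ->
  T = nu%:M + e *: (V *m D) -> nu_of T D = nu /\ eps_of T D V = e.
Proof.
move=> n1 /row_sqnorm_neq0 D0 /col_sqnorm_neq0 V0 TE.
have n10 : n%:R - 1 != 0 :> R by rewrite subr_eq0 (eqr_nat R n 1); case: n n1 => [|[]].
have mM (p q : 'M[R]_1) : (p *m q) 0 0 = p 0 0 * q 0 0.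
  by rewrite mxE big_ord1.
have E1 : (D *m T *m D^T) 0 0 = nu * (D *m D^T) 0 0 + e * ((D *m V) 0 0 * (D *m D^T) 0 0).
  rewrite TE mulmxDr mulmxDl mul_mx_scalar -!scalemxAr -!scalemxAl !entE mulmxA.
  by rewrite -[D *m V *m D *m _]mulmxA mM.
have E2 : \tr T = n%:R * nu + e * (D *m V) 0 0.
  rewrite TE linearD linearZ /= mxtrace_scalar mxtrace_mulC mulr_natl.
  by rewrite [\tr (D *m V)]big_ord1.
have E3 : (V^T *m T *m D^T) 0 0 = nu * (V^T *m D^T) 0 0
     + e * ((V^T *m V) 0 0 * (D *m D^T) 0 0).
  rewrite TE mulmxDr mulmxDl mul_mx_scalar -!scalemxAr -!scalemxAl !entE mulmxA.
  by rewrite -[V^T *m V *m D *m _]mulmxA mM.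
have nuE : nu_of T D = nu by rewrite /nu_of E1 E2; field; rewrite D0 n10.
by split=> //; rewrite /eps_of nuE E3; field; rewrite V0 D0.
Qed.

End Coefficients.

Section SmoothCoefficients.
Variables (R : realType) (n : nat) (U : set 'rV[R]_n).
Hypothesis oU : open U.
Variables (T : 'rV[R]_n -> 'M[R]_n) (D : 'rV[R]_n -> 'rV[R]_n) (V : 'rV[R]_n -> 'cV[R]_n).
Hypotheses (sT : smx U T) (sD : smx U D) (sV : smx U V).
Hypothesis D0 : forall x, U x -> D x != 0.
Hypothesis V0 : forall x, U x -> V x != 0.

Lemma smooth_nu_of : smooth_on U (fun x => nu_of (T x) (D x)).
Proof.
have sDT := smx_tr oU sD.
apply: smooth_mul => //; last exact: smooth_cst.
apply: smooth_subf => //; first exact: smooth_trace.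
apply: smooth_mul => //.
  apply: smooth_inv => // [x /D0|]; first exact: row_sqnorm_neq0.
  exact: (smx_mul oU sD sDT).
exact: (smx_mul oU (smx_mul oU sD sT) sDT).
Qed.

Lemma smooth_eps_of : smooth_on U (fun x => eps_of (T x) (D x) (V x)).
Proof.
have sDT := smx_tr oU sD; have sVT := smx_tr oU sV.
apply: smooth_mul => //.
  apply: smooth_subf => //; first exact: (smx_mul oU (smx_mul oU sVT sT) sDT).
  apply: smooth_mul => //; first exact: smooth_nu_of.
  exact: (smx_mul oU sVT sDT).
apply: smooth_inv => // [x Ux|].
  by rewrite mulf_neq0 ?row_sqnorm_neq0 ?col_sqnorm_neq0 // ?D0 ?V0.
apply: smooth_mul => //; first exact: (smx_mul oU sVT sV).
exact: (smx_mul oU sD sDT).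
Qed.

End SmoothCoefficients.

Lemma open_neq0 (R : realType) (n : nat) (U : set 'rV[R]_n) (f : 'rV[R]_n -> R) :
  open U -> smooth_on U f -> open [set x | U x /\ f x != 0].
Proof.
move=> oU sf; rewrite openE => x /= [Ux fx]; rewrite /interior /=.
have cf := smooth_cont sf Ux.
have nU : \forall y \near x, U y by exact: open_nbhs_nbhs.
have nf : \forall y \near x, f y != 0.
  have := cf [set z | z != 0]; apply.
  by apply: open_nbhs_nbhs; split=> //; exact: open_neq.
by apply: filterS2 nU nf => y.
Qed.

(** * The pointwise form of T within one chart *)

Section LocalSpan.
Variables (R : realType) (n : nat) (U : set 'rV[R]_n).
Hypothesis n2 : (2 < n)%N.
Hypothesis oU : open U.
Variable G : 'rV[R]_n -> 'M[R]_n.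
Hypothesis sG : smx U G.
Hypothesis Gs : forall x, U x -> (G x)^T = G x.
Hypothesis Gu : forall x, U x -> G x \in unitmx.
Variables (S : 'rV[R]_n -> 'M[R]_n) (l : 'rV[R]_n -> 'cV[R]_n) (w : R).
Hypothesis sS : smx U S.
Hypothesis Ss : forall x, U x -> (S x)^T = S x.
Hypothesis sl : smx U l.
Implicit Types (x y : 'rV[R]_n) (a b c d : 'I_n).

Local Notation bas := (bas R).
Local Notation Gam := (Gam G).
Local Notation Om := (Om G).
Local Notation tGam := (tGam G w).
Local Notation nabl := (nabl G l w).

Hypothesis HS : forall x c, U x -> pdm c S x =
  bas c *m (l x)^T + l x *m (bas c)^T
  - (Gam c x *m S x + S x *m (Gam c x)^T) - tGam c x *: S x.

Variables B : 'rV[R]_n -> R.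
Hypothesis sB : smooth_on U B.
Local Notation Z := (Zc G B).
Local Notation T := (fun x => S x *m G x).

Lemma selfadj_T x : U x -> selfadj (G x) (T x).
Proof. by move=> Ux; rewrite /selfadj !trmx_mul Gs // Ss // mulmxA. Qed.

Lemma Zc_anti x c d : U x -> (Z c d x)^T *m G x = - (G x *m Z c d x).
Proof.
move=> Ux; rewrite /Zc trD trN trZ trD trN !trmx_mul !trmxK Gs //.
rewrite ?mulmxDl ?mulmxDr ?mulNmx ?mulmxN -?scalemxAl -?scalemxAr.
rewrite ?mulmxDl ?mulmxDr ?mulNmx ?mulmxN ?scalerDr ?scalerN !mulmxA.
rewrite (Om_anti oU sG Gs Gu c d Ux).
by apply/matrixP => i j; rewrite !entE; ring.
Qed.

Lemma Zc_pair x a b c d : U x -> (G x *m Z c d x) a b = (G x *m Z a b x) c d.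
Proof.
move=> Ux.
have E e f i j : (G x *m Z e f x) i j = (G x *m Om e f x) i j
    - B x * (G x i e * G x f j - G x i f * G x e j).
  have P (u v : 'I_n) : (G x *m (bas u *m (bas v)^T *m G x)) i j = G x i u * G x v j.
    have -> : G x *m (bas u *m (bas v)^T *m G x) = (G x *m bas u) *m ((bas v)^T *m G x).
      by rewrite !mulmxA.
    rewrite mul_bas /bas trmx_delta -rowE mxE big_ord1.
    by rewrite !mxE.
  by rewrite /Zc mulmxBr -scalemxAr mulmxBr !entE !P; ring.
rewrite !E (Om_pair oU sG Gs Gu a b c d Ux).
rewrite (G_entry_sym Gs a c Ux) (G_entry_sym Gs a d Ux).
by rewrite (G_entry_sym Gs d b Ux) (G_entry_sym Gs c b Ux); ring.
Qed.

(* The column [c] is nabla_c lambda + B T e_c. *)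
Definition Lam x : 'M[R]_n := \matrix_(i, j) nabl j x i 0 + B x *: T x.

Lemma mul_Lam_bas x c : Lam x *m bas c = nabl c x + B x *: (T x *m bas c).
Proof.
rewrite mulmxDl -scalemxAl; congr (_ + _); rewrite mul_bas.
by apply/colP => i; rewrite !mxE.
Qed.

Lemma smx_Lam : smx U Lam.
Proof.
apply: smx_add => //.
  move=> i j; apply: (@smooth_ext _ _ _ (fun x => nabl j x i 0)) => // [x _|].
    by rewrite mxE.
  exact: (smx_nabl oU sG Gu w sl j i 0).
apply: smx_scale => //; exact: smx_mul.
Qed.

(** Applied to S, the constant curvature part produces exactly the terms in B T that turn the
    derivative of lambda into [Lam]. *)
Lemma commutator_Zc x c d : U x ->
  Z c d x *m S x + S x *m (Z c d x)^T =
  bas d *m (Lam x *m bas c)^T + Lam x *m bas c *m (bas d)^T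
  - (bas c *m (Lam x *m bas d)^T + Lam x *m bas d *m (bas c)^T).
Proof.
move=> Ux; have := commutator_S oU sG Gs Gu sS sl HS c d Ux.
rewrite !mul_Lam_bas /Zc !trD !trN !trZ !trD !trN !trmx_mul !trmxK (Gs Ux) (Ss Ux).
rewrite ?mulmxDl ?mulmxDr ?mulNmx ?mulmxN -?scalemxAl -?scalemxAr.
rewrite ?mulmxDl ?mulmxDr ?mulNmx ?mulmxN ?scalerDr ?scalerN !mulmxA.
move=> /matrixP e; apply/matrixP => i j; move: (e i j); rewrite !entE; lra.
Qed.

(** The vector v is killed as an argument of the endomorphisms Z; pair symmetry and skewness carry
    this over to the contraction of v with a form index. The contracted commutator then has the
    shape treated by [scalar_of_nullity]. *)
Lemma Lam_scalar_at_nullity x (v : 'cV[R]_n) : U x -> v != 0 ->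
  (forall c d, Z c d x *m v = 0) -> exists k, Lam x = k%:M.
Proof.
move=> Ux v0 Zv; apply: (scalar_of_nullity (w := Lam x *m v) v0) => d.
have Zv2 : \sum_c v c 0 *: Z c d x = 0.
  rewrite -[LHS](mulKmx (Gu Ux)) mulmx_sumr.
  suff -> : \sum_c G x *m (v c 0 *: Z c d x) = 0 by rewrite mulmx0.
  apply/matrixP => a b; rewrite summxE mxE.
  have : ((G x *m Z a b x)^T *m v) d 0 = 0.
    by rewrite trmx_mul Gs // Zc_anti // mulNmx -mulmxA Zv mulmx0 oppr0 mxE.
  rewrite mxE => e0; rewrite -[RHS]e0; apply: eq_bigr => c _.
  by rewrite -scalemxAr entZ (Zc_pair _ _ _ _ Ux) mulrC [in RHS]mxE.
have E : \sum_c v c 0 *: (Z c d x *m S x + S x *m (Z c d x)^T) = 0.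
  under eq_bigr do rewrite scalerDr scalemxAl scalemxAr -trZ.
  by rewrite big_split /= -mulmx_suml -mulmx_sumr -linear_sum /= Zv2 mul0mx trmx0 mulmx0 addr0.
move: E; under eq_bigr do rewrite commutator_Zc //.
have S1 (A : 'M[R]_n) : \sum_c v c 0 *: (bas d *m (A *m bas c)^T) = bas d *m (A *m v)^T.
  rewrite -(mul_sum_bas A v) [X in _ *m X]linear_sum mulmx_sumr.
  by apply: eq_bigr => c _; rewrite /= trZ scalemxAr.
have S2 (A : 'M[R]_n) : \sum_c v c 0 *: (A *m bas c *m (bas d)^T) = A *m v *m (bas d)^T.
  by rewrite -(mul_sum_bas A v) mulmx_suml; apply: eq_bigr => c _; rewrite scalemxAl.
have S3 (u : 'cV[R]_n) : \sum_c v c 0 *: (bas c *m u^T) = v *m u^T.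
  by rewrite -{2}(sum_bas v) mulmx_suml; apply: eq_bigr => c _; rewrite scalemxAl.
have S4 (u : 'cV[R]_n) : \sum_c v c 0 *: (u *m (bas c)^T) = u *m v^T.
  rewrite -{2}(sum_bas v) linear_sum mulmx_sumr; apply: eq_bigr => c _.
  by rewrite /= trZ scalemxAr.
under eq_bigr do rewrite scalerBr !scalerDr.
rewrite sumrB !big_split /= S1 S2 S3 S4 => /eqP; rewrite subr_eq0 => /eqP <-.
by [].
Qed.

(** Nullity provides the scalar only point by point; as a normalised trace it is smooth and defined
    on all of U. *)
Definition kap x : R := (n%:R)^-1 * \tr (Lam x).

Lemma smooth_kap : smooth_on U kap.
Proof.
apply: smooth_mul => //; first exact: smooth_cst.
by apply: smooth_trace => //; exact: smx_Lam.
Qed.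

(* The identity holds on the dense set of nullity points and both sides are
   continuous. *)
Lemma Lam_scalar : (forall V : set 'rV[R]_n, open V -> V `<=` U -> V !=set0 ->
    exists x (v : 'cV[R]_n), [/\ V x, v != 0 & forall c d, Z c d x *m v = 0]) ->
  forall x, U x -> Lam x = (kap x)%:M.
Proof.
move=> dens x Ux; apply/matrixP => i j.
apply/eqP; rewrite -subr_eq0; apply/negPn/negP => ne.
pose f y := Lam y i j - ((kap y)%:M : 'M[R]_n) i j.
have sf : smooth_on U f.
  apply: smooth_subf => //; first exact: smx_Lam.
  by apply: (smx_scalar oU); exact: smooth_kap.
have [|||y [v [[Uy fy] v0 Zv]]] := dens [set y | U y /\ f y != 0].
- exact: open_neq0.
- by move=> y [].
- by exists x.
have [k Lk] := Lam_scalar_at_nullity Uy v0 Zv.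
move: fy; rewrite /f /kap Lk mxtrace_scalar -[k *+ n]mulr_natl mulKf ?subrr ?eqxx //.
by rewrite pnatr_eq0; case: n n2.
Qed.

Hypothesis HL : forall x, U x -> Lam x = (kap x)%:M.

Lemma nablE x c : U x -> nabl c x = kap x *: bas c - B x *: (T x *m bas c).
Proof. by move=> Ux; rewrite -mul_scalar_mx -HL // mul_Lam_bas addrK. Qed.

(** For scalar [Lam] the right side of [commutator_Zc] cancels, so Z S + S Z^T = 0; multiplication
    by G and skewness turn this into commutation with T. *)
Lemma Zc_T x c d : U x -> Z c d x *m T x = T x *m Z c d x.
Proof.
move=> Ux; have := commutator_Zc c d Ux; rewrite HL // !mul_scalar_mx !trZ.
rewrite -!scalemxAl -!scalemxAr.
have -> (A C : 'M[R]_n) k : k *: A + k *: C - (k *: C + k *: A) = 0.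
  by apply/matrixP => i j; rewrite !entE; ring.
move=> /eqP; rewrite addr_eq0 => /eqP e.
by rewrite mulmxA e mulNmx -!mulmxA Zc_anti // mulmxN opprK.
Qed.

Definition dB x : 'rV[R]_n := \row_c partial c B x.
(* The one-form b of the displayed formula in the header; it is d kappa + 2 B lambda,
   where kappa is a density. *)
Definition bl x : 'rV[R]_n :=
  \row_e (partial e kap x + tGam e x * kap x) + (2 * B x) *: ((l x)^T *m G x).

Lemma smx_dB : smx U dB.
Proof.
move=> i j; apply: (@smooth_ext _ _ _ (partial j B)) => // [x _|].
  by rewrite mxE.
exact: smooth_partial.
Qed.

Lemma smx_bl : smx U bl.
Proof.
apply: smx_add => //.
  move=> i j; apply: (@smooth_ext _ _ _ (fun x => partial j kap x + tGam j x * kap x)) => //.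
    by move=> x _; rewrite mxE.
  apply: smooth_add => //; first by apply: smooth_partial; exact: smooth_kap.
  by apply: smooth_mul => //; [exact: smooth_tGam|exact: smooth_kap].
apply: smx_scale => //; first by apply: smooth_mul => //; exact: smooth_cst.
by apply: smx_mul => //; exact: smx_tr.
Qed.

Lemma Zc_lE x c d : U x -> Z c d x *m l x =
  bl x 0 c *: bas d - bl x 0 d *: bas c
   - dB x 0 c *: (T x *m bas d) + dB x 0 d *: (T x *m bas c).
Proof.
move=> Ux.
rewrite (Zc_l oU sG Gs Gu sS sl HS sB smooth_kap nablE c d Ux).
by rewrite ![dB x _ _]mxE.
Qed.

Lemma derivative_T x c : U x -> pdm c T x =
  symprod (G x) (l x) (bas c) - Gam c x *m T x + T x *m Gam c x - tGam c x *: T x.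
Proof.
move=> Ux; rewrite (pdmM oU Ux _ sS sG) (HS _ Ux) (metric_compat oU Gs Gu _ Ux) /symprod.
rewrite ?mulmxDl ?mulmxDr ?mulNmx ?mulmxN -?scalemxAl -?scalemxAr.
rewrite ?mulmxDl ?mulmxDr ?mulNmx ?mulmxN -?scalemxAl -?scalemxAr !mulmxA.
by apply/matrixP => i j; rewrite !entE; ring.
Qed.

(** The residual [res] vanishes exactly where T is in the span, so near a counterexample the
    quadratic alternative persists and can be differentiated. *)
Lemma local_span x : U x -> dB x != 0 -> in_span (G x) (T x) (dB x).
Proof.
move=> Ux D0; apply/not_notP => nspan.
have [a Da] := row_neq0 D0.
pose U1 := [set y | U y /\ dB y 0 a != 0].
have oU1 : open U1 by apply: open_neq0 => //; exact: smx_dB.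
have U1U : U1 `<=` U by move=> y [].
pose gr y : 'cV[R]_n := invmx (G y) *m (dB y)^T.
have sT : smx U T by exact: smx_mul.
have sgr : smx U gr by apply: smx_mul; [|exact: smx_inv|exact: smx_tr smx_dB].
have dB0 y : U1 y -> dB y != 0.
  by move=> [_]; apply: contraNneq => ->; rewrite mxE.
have gr0 y : U1 y -> gr y != 0.
  move=> U1y; apply: contraNneq (dB0 y U1y) => h; rewrite -[dB y]trmxK.
  by rewrite -[(dB y)^T](mulKVmx (Gu (U1U _ U1y))) -/(gr y) h mulmx0 trmx0.
have sub p q (F : 'rV[R]_n -> 'M[R]_(p, q)) : smx U F -> smx U1 F.
  by move=> sF i j; exact: smooth_subset (sF i j).
pose res y := T y - (nu_of (T y) (dB y))%:M - eps_of (T y) (dB y) (gr y) *: (gr y *m dB y).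
have sres : smx U1 res.
  apply: smx_add => //; [apply: smx_add|apply: smx_opp] => //.
  - exact: sub.
  - apply: smx_opp => //; apply: smx_scalar => //.
    by apply: smooth_nu_of => //; apply: sub => //; exact: smx_dB.
  - apply: smx_scale => //.
      by apply: smooth_eps_of => //; apply: sub => //; exact: smx_dB.
    by apply: smx_mul => //; apply: sub => //; exact: smx_dB.
have res0 y : U1 y -> in_span (G y) (T y) (dB y) -> res y = 0.
  move=> U1y [nu [e TE]]; have n1 : (1 < n)%N by exact: ltn_trans n2.
  rewrite -/(gr y) in TE.
  have [nuE eE] := coefficients_unique n1 (dB0 y U1y) (gr0 y U1y) TE.
  by rewrite /res nuE eE {1}TE [_%:M + _]addrC addrK subrr.
have [i [j rij]] : exists i j, res x i j != 0.
  apply: contrapT => h; apply: nspan.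
  exists (nu_of (T x) (dB x)), (eps_of (T x) (dB x) (gr x)).
  have : res x = 0.
    apply/matrixP => i j; rewrite [RHS]mxE; apply/eqP/negPn/negP => r.
    by apply: h; exists i, j.
  by move=> /eqP; rewrite /res -addrA -opprD subr_eq0 => /eqP.
pose V := [set y | U1 y /\ res y i j != 0].
have oV : open V by apply: open_neq0 => //; exact: sres.
have VU1 : V `<=` U1 by move=> y [].
have VU : V `<=` U by move=> y /VU1 /U1U.
have Vx : V x by [].
(* Component a of b + dB T = p dB and of b T = - q dB; fixing one a with nonzero dB_a makes p and q
   smooth. *)
pose pf y := (bl y + dB y *m T y) 0 a * (dB y 0 a)^-1.
pose qf y := - (bl y *m T y) 0 a * (dB y 0 a)^-1.
have TT y : V y -> T y *m T y = pf y *: T y + (qf y)%:M.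
  move=> Vy; have Uy := VU y Vy; have [[_ Dya] ry] := Vy.
  have [sp|[p [q [e1 e2 ->]]]] := curvature_alternative (Gu Uy) (Gs Uy)
     (selfadj_T Uy) (dB0 y (VU1 y Vy)) (fun c d => Zc_T c d Uy)
     (fun c d i j => Zc_pair i j c d Uy) (fun c d => Zc_lE c d Uy).
    by move: ry; rewrite (res0 y (VU1 y Vy) sp) mxE eqxx.
  by rewrite /pf /qf e1 e2 entN !entZ opprK !mulfK.
have subV p q (F : 'rV[R]_n -> 'M[R]_(p, q)) : smx U F -> smx V F.
  by move=> sF k m; exact: smooth_subset (sF k m).
have sTV := subV _ _ _ sT; have sdBV := subV _ _ _ smx_dB; have sblV := subV _ _ _ smx_bl.
have sinv : smooth_on V (fun y => (dB y 0 a)^-1).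
  by apply: (smooth_inv oV) => [y [[_ ?] _] //|]; exact: sdBV.
have spf : smooth_on V pf.
  apply: smooth_mul => //; apply: (smx_add oV) => //; exact: smx_mul.
have sqf : smooth_on V qf.
  apply: smooth_mul => //; apply: smooth_opp => //; exact: (smx_mul oV sblV sTV).
have D1 c : pdm c T x *m T x + T x *m pdm c T x =
    partial c pf x *: T x + pf x *: pdm c T x + (partial c qf x)%:M.
  rewrite -(pdmM oV Vx _ sTV sTV).
  transitivity (pdm c (fun y => pf y *: T y + (qf y)%:M) x).
    by apply: (pdm_ext oV) => // y Vy; exact: TT.
  have m1 := smx_scale oV spf sTV; have m2 : smx V (fun y => (qf y)%:M : 'M[R]_n) by exact: (smx_scalar oV).
  by rewrite (pdmD oV Vx _ m1 m2) (pdmZ oV Vx _ spf sTV) (pdm_scalar oV Vx n c sqf).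
apply: nspan.
(* p has the weight of T and q twice that weight, so these P and Q are covariant derivatives. The
   remaining Christoffel terms are commutators, which cancel by the quadratic relation. *)
apply: (span_of_quadratic n2 (Gu Ux) (Gs Ux) (selfadj_T Ux) D0 (fun c d => Zc_T c d Ux)
  (fun c d => Zc_anti c d Ux) (fun c d => Zc_lE c d Ux) (p := pf x)
  (P := \row_c (partial c pf x + tGam c x * pf x))
  (Q := \row_c (partial c qf x + 2 * tGam c x * qf x))) => c.
have := D1 c; rewrite !(derivative_T c Ux) !mxE.
move: (TT x Vx); move: (T x) (symprod _ _ _) => Tx X TTx.
rewrite ?mulmxDl ?mulmxDr ?mulNmx ?mulmxN -?scalemxAl -?scalemxAr.
rewrite -!mulmxA TTx ?mulmxDr !mulmxA TTx ?mulmxDl mul_scalar_mx mul_mx_scalar.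
rewrite -?scalemxAl -?scalemxAr => /matrixP e; apply/matrixP => k m; move: (e k m).
have entS (r : R) : (r%:M : 'M[R]_n) k m = r * (k == m)%:R by rewrite mxE mulr_natr.
rewrite !entE !entS; lra.
Qed.

End LocalSpan.

(** * From charts to the manifold *)

Section Charts.
Variables (R : realType) (n : nat) (M : manifold R n).
Implicit Types (i j : chart_index M) (p q : M) (U W : set M) (x y : 'rV[R]_n).

Local Notation co i := (coord (charts i)).
Local Notation ci i := (coord_inv (charts i)).

Lemma in_chartP i U x : in_chart i U x ->
  [/\ dom (charts i) (ci i x), U (ci i x) & co i (ci i x) = x].
Proof. by move=> [p [dp Up] <-]; rewrite coordK. Qed.

Lemma in_chart_sub i U W : U `<=` W -> in_chart i U `<=` in_chart i W.
Proof. by move=> UW x [p [dp Up] <-]; exists p => //; split=> //; exact: UW. Qed.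

Lemma in_chart_coord i U p : dom (charts i) p -> U p -> in_chart i U (co i p).
Proof. by move=> dp Up; exists p. Qed.

Lemma open_in_chart i U : open U -> open (in_chart i U).
Proof.
move=> oU; rewrite openE => x Ux; have [dx Uix ex] := in_chartP Ux.
have xi : (co i @` dom (charts i)) x by exists (ci i x).
have n1 : nbhs x (co i @` dom (charts i)).
  by apply: open_nbhs_nbhs; split=> //; exact: coord_img_open.
have n2 : \forall y \near x, U (ci i y).
  by have := coord_inv_cont xi; apply; apply: open_nbhs_nbhs.
apply: filterS2 n1 n2 => y [q dq <-]; rewrite coordK // => Uq.
exact: in_chart_coord.
Qed.

Lemma open_chart_preimage i (V : set 'rV[R]_n) : open V ->
  open [set p | dom (charts i) p /\ V (co i p)].
Proof.
move=> oV; rewrite openE => p [dp Vp].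
have n1 : nbhs p (dom (charts i)).
  by apply: open_nbhs_nbhs; split=> //; exact: dom_open.
have n2 : \forall q \near p, V (co i q).
  by have := coord_cont dp; apply; apply: open_nbhs_nbhs.
by apply: filterS2 n1 n2 => q.
Qed.

Lemma change_coord i j p : dom (charts i) p -> change i j (co i p) = co j p.
Proof. by move=> dp; rewrite /change /transition coordK. Qed.

Variable B : M -> R.
Hypothesis sB : smooth_function B.

Definition drow i x : 'rV[R]_n := \row_a dfun B i x a.

Lemma dfun_change i j p : dom (charts i) p -> dom (charts j) p ->
  drow i (co i p) = drow j (co j p) *m Jac i j (co i p).
Proof.
move=> di dj; apply/rowP => b; rewrite !mxE.
have ox : overlap i j (co i p) by exact: in_chart_coord.
have oo : open (overlap i j) by apply: open_in_chart; exact: dom_open.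
transitivity (partial b (fun y => fun_in B j (change i j y)) (co i p)).
  rewrite /dfun; apply: (partial_ext b oo ox) => y oy.
  have [dy djy ey] := in_chartP oy.
  by rewrite /fun_in /change /transition coordK.
rewrite (partial_chain (F := fun_in B j)).
- by rewrite change_coord //; apply: eq_bigr => a _; rewrite !mxE.
- by move=> a; exact: smooth_diff (transition_smooth i j a) ox.
- rewrite change_coord //; apply: (smooth_diff (sB j)).
  exact: in_chart_coord.
Qed.

Lemma drow_neq0 i x : reflect (exists a, dfun B i x a != 0) (drow i x != 0).
Proof.
apply: (iffP idP) => [|[a Da]].
  apply: contraNP => h; apply/eqP/rowP => a; rewrite !mxE; apply/eqP/negPn/negP => Da.
  by apply: h; exists a.
by apply: contraNneq Da => /rowP/(_ a); rewrite !mxE => ->.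
Qed.

Lemma dfun_nonzeroP i p : dom (charts i) p ->
  dfun_nonzero_at B p <-> drow i (co i p) != 0.
Proof.
move=> di; split=> [/(_ i di)/drow_neq0 //|D0] j dj; apply/drow_neq0.
by apply: contraNneq D0 => h; rewrite (dfun_change di dj) h mul0mx.
Qed.

Lemma smx_drow i : smx (in_chart i setT) (drow i).
Proof.
move=> k a; apply: (@smooth_ext _ _ _ (dfun B i ^~ a)).
- by apply: open_in_chart; exact: openT.
- by move=> x _; rewrite mxE.
- exact: smooth_partial.
Qed.

Lemma open_dfun_nonzero : open [set p | dfun_nonzero_at B p].
Proof.
rewrite openE => p Dp; have [i di] := charts_cover p.
have /drow_neq0[a Da] := (dfun_nonzeroP di).1 Dp.
have oX : open (in_chart i (@setT M)) by apply: open_in_chart; exact: openT.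
have oV := open_chart_preimage i (open_neq0 oX (smx_drow i 0 a)).
have : nbhs p [set q | dom (charts i) q /\
    [set x | in_chart i setT x /\ drow i x 0 a != 0] (co i q)].
  apply: open_nbhs_nbhs; split=> //=; split=> //; split; first exact: in_chart_coord.
  by rewrite mxE.
apply: filterS => q [dq [_ Dq]]; apply/(dfun_nonzeroP dq).
by apply: contraNneq Dq => ->; rewrite mxE.
Qed.

(** If dB vanished on a nonempty open set, B would be constant near each of its points, one of which
    is a point of non-constancy. *)
Lemma dense_dfun_nonzero : on_open_dense (nonconstant_at B) ->
  dense [set p | dfun_nonzero_at B p].
Proof.
move=> [Q [_ dQ ncQ]] W W0 oW; have [p [Wp Qp]] := dQ W W0 oW.
apply/set0P/negP => /eqP WU; apply: (ncQ p Qp).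
have [i di] := charts_cover p.
have oV : open (in_chart i W) by exact: open_in_chart.
have : nbhs (co i p) (in_chart i W).
  by apply: open_nbhs_nbhs; split=> //; exact: in_chart_coord.
move=> /nbhs_ballP[r /= r0 Hr].
have cst := @locally_constant R n (fun_in B i) (co i p) r.
have H z : ball (co i p) r z ->
    differentiable (fun_in B i) z /\ forall a, partial a (fun_in B i) z = 0.
  move=> /Hr Wz; have [dz Wiz ez] := in_chartP Wz; split.
    apply: (smooth_diff (sB i)); exact: in_chart_sub Wz.
  move=> a; apply/eqP/negPn/negP => Da.
  have : (W `&` [set p | dfun_nonzero_at B p]) (ci i z).
    by split=> //; apply/(dfun_nonzeroP dz)/drow_neq0; exists a; rewrite ez.
  by rewrite WU.
have nb : nbhs p [set q | dom (charts i) q /\ ball (co i p) r (co i q)].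
  have n1 : nbhs p (dom (charts i)).
    by apply: open_nbhs_nbhs; split=> //; exact: dom_open.
  have n2 : \forall q \near p, ball (co i p) r (co i q).
    by have := coord_cont di; apply; exact: nbhsx_ballx.
  by apply: filterS2 n1 n2 => q.
apply: filterS nb => q [dq bq]; have := cst H _ bq.
by rewrite /fun_in !coordK.
Qed.

End Charts.

(** * Component formulas in matrix form *)

Section Dictionary.
Variables (R : realType) (n : nat) (M : manifold R n) (g : metric M).
Implicit Types (i j : chart_index M) (p : M) (x y : 'rV[R]_n) (a b c d : 'I_n).

Local Notation X i := (in_chart i (@setT M)).

Lemma open_X i : open (X i).
Proof. by apply: open_in_chart; exact: openT. Qed.

Lemma christoffelE i x a c b : christoffel g i x a c b = Gam (g i) c x a b.
Proof.
rewrite Gam.unlock Gam1.unlock [RHS]mxE /christoffel mulr_sumr.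
by apply: eq_bigr => d _; rewrite [in RHS]mxE mulrCA mulrA.
Qed.

Lemma riemannE i x a b c d : riemann g i x a b c d = Om (g i) c d x a b.
Proof.
rewrite Om.unlock !entD !entN !pdmE /riemann.
have E e f h : (fun y => christoffel g i y e f h) = (fun y => Gam (g i) f y e h).
  by apply/funext => y; rewrite christoffelE.
rewrite !E; congr (_ + _); rewrite sumrB ![(_ *m _) _ _]mxE.
by congr (_ - _); apply: eq_bigr => e _; rewrite !christoffelE.
Qed.

Lemma nabla_sym2E (w : R) (s : weighted_sym2 M w) i x a b c :
  nabla_sym2 g s i x a b c =
  (pdm a (s i) x + (Gam (g i) a x *m s i x + s i x *m (Gam (g i) a x)^T)
   + tGam (g i) (w / n.+1%:R) a x *: s i x) b c.
Proof.
rewrite !entD pdmE entZ /nabla_sym2 /tGam; congr (_ + _ + _).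
  rewrite big_split /= ![(_ *m _) _ _]mxE; congr (_ + _).
    by apply: eq_bigr => d _; rewrite christoffelE.
  by apply: eq_bigr => d _; rewrite christoffelE mulrC [in RHS]mxE.
by congr (_ * _ * _); apply: eq_bigr => d _; rewrite christoffelE.
Qed.

Lemma ricci_sym i x b d : X i x -> ricci g i x b d = ricci g i x d b.
Proof.
move=> Xx; have oX : open (X i) by exact: open_X.
have Gs y : X i y -> (g i y)^T = g i y by exact: met_sym.
have Gu y : X i y -> g i y \in unitmx by exact: met_nondegenerate.
have sG : smx (X i) (g i) by move=> ? ?; exact: met_smooth.
have E e f : ricci g i x e f =
    \sum_a \sum_k invmx (g i x) a k * (g i x *m Om (g i) a f x) k e.
  apply: eq_bigr => a _; rewrite riemannE -[in LHS](mulKmx (Gu _ Xx) (Om _ _ _ _)).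
  by rewrite mxE.
have iGs a k : invmx (g i x) a k = invmx (g i x) k a.
  by rewrite -[in LHS](Gs _ Xx) -trmx_inv mxE.
rewrite !E [RHS]exchange_big; apply: eq_bigr => a _; apply: eq_bigr => k _.
by rewrite iGs (Om_pair oX sG Gs Gu _ _ _ _ Xx).
Qed.

(** On a nullity vector the Schouten tensor acts as B times the metric, so the Schouten terms of the
    Weyl tensor become the constant curvature term of [Zc]. *)
Lemma nullity_Zc (B : M -> R) p (v : chart_index M -> 'cV[R]_n) i c d :
  nullity_function g B -> in_weyl_nullity g p v -> dom (charts i) p ->
  Zc (g i) (fun_in B i) c d (coord (charts i) p) *m v i = 0.
Proof.
move=> hB vN di; have hP := hB p v vN i di; have [_ /(_ i di) hW] := vN.
set x := coord (charts i) p in hP hW *.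
have Xx : X i x by exact: in_chart_coord.
have Gu : g i x \in unitmx by exact: met_nondegenerate.
have Bp : fun_in B i x = B p by rewrite /fun_in /x coordK.
(* The Weyl tensor contracts v with the first Schouten index and [schouten_up] with the second;
   symmetry of Ricci reconciles them. *)
have PB e : \sum_b schouten g i x b e * v i b 0 = B p * (g i x *m v i) e 0.
  pose P : 'M[R]_n := \matrix_(a, b) schouten g i x a b.
  have Pv : invmx (g i x) *m P *m v i = B p *: v i.
    apply/colP => a; rewrite entZ -hP mxE; apply: eq_bigr => b _; congr (_ * _).
    by rewrite mxE; apply: eq_bigr => k _; rewrite mxE.
  have : P *m v i = B p *: (g i x *m v i).
    by rewrite -(mulKVmx Gu (P *m v i)) [invmx _ *m _]mulmxA Pv scalemxAr.
  move=> /colP/(_ e); rewrite entZ mxE => <-; apply: eq_bigr => b _.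
  by rewrite mxE /schouten (ricci_sym b e Xx).
apply/colP => a; rewrite [RHS]mxE -(hW a c d) /Zc mulmxBl -scalemxAl mulmxBl !entD !entN entZ.
rewrite !entD !entN Bp.
have K (k m : 'I_n) : (bas R k *m (bas R m)^T *m g i x *m v i) a 0 =
    (a == k)%:R * (g i x *m v i) m 0.
  have -> : bas R k *m (bas R m)^T *m g i x *m v i =
            bas R k *m ((bas R m)^T *m (g i x *m v i)) by rewrite !mulmxA.
  by rewrite {2}/bas trmx_delta -rowE mxE big_ord1 !mxE eqxx andbT.
rewrite !K.
have -> : (Om (g i) c d x *m v i) a 0 = \sum_b riemann g i x a b c d * v i b 0.
  by rewrite mxE; apply: eq_bigr => b _; rewrite riemannE.
transitivity (\sum_b riemann g i x a b c d * v i b 0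
    + (a == d)%:R * (\sum_b schouten g i x b c * v i b 0)
    - (a == c)%:R * (\sum_b schouten g i x b d * v i b 0)).
  by rewrite !PB; ring.
rewrite !mulr_sumr -big_split -sumrB; apply: eq_bigr => b _.
by rewrite /weyl /=; ring.
Qed.

End Dictionary.

(** * Decomposition of a solution on the manifold *)

Section Solutions.
Variables (R : realType) (n : nat) (M : manifold R n) (g : metric M).
Hypothesis n2 : (2 < n)%N.
Variable B : M -> R.
Hypothesis sB : smooth_function B.
Variable sigma : weighted_sym2 M (- 2%:R).
Implicit Types (i j : chart_index M) (p : M) (x y : 'rV[R]_n) (a b c d : 'I_n).

Local Notation X i := (in_chart i (@setT M)).
Local Notation T i x := (sigma i x *m g i x).
Local Notation D i x := (drow B i x).

(** This is lambda: contracting a with b in delta_a^b lambda^c + delta_a^c lambda^b gives (n + 1)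
    lambda^c. *)
Definition sigma_div i x : 'cV[R]_n :=
  \col_c (n.+1%:R^-1 * \sum_d nabla_sym2 g sigma i x d d c).

Lemma smx_sigma_div i : smx (X i) (sigma_div i).
Proof.
have oX : open (X i) by exact: open_X.
have Gu y : X i y -> g i y \in unitmx by exact: met_nondegenerate.
have sG : smx (X i) (g i) by move=> ? ?; exact: met_smooth.
have sS : smx (X i) (sigma i) by move=> ? ?; exact: ws2_smooth.
move=> c k; apply: (@smooth_ext _ _ _
  (fun x => n.+1%:R^-1 * \sum_d nabla_sym2 g sigma i x d d c)) => // [x _|].
  by rewrite mxE.
apply: smooth_mul => //; first exact: smooth_cst.
apply: smooth_bigsum => // d.
pose F x := pdm d (sigma i) x
   + (Gam (g i) d x *m sigma i x + sigma i x *m (Gam (g i) d x)^T)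
   + tGam (g i) (- 2%:R / n.+1%:R) d x *: sigma i x.
have sGam := smx_Gam oX sG Gu d.
have sF : smx (X i) F.
  apply: smx_add => //; last by apply: smx_scale => //; exact: smooth_tGam.
  apply: smx_add => //; first exact: smx_pdm.
  apply: smx_add => //; apply: smx_mul => //.
  exact: smx_tr.
apply: smooth_ext (sF d c) => // x _.
by rewrite nabla_sym2E.
Qed.

Lemma metrisability_normal_form i x c : metrisability_solution g sigma -> X i x ->
  pdm c (sigma i) x =
  bas R c *m (sigma_div i x)^T + sigma_div i x *m (bas R c)^T
  - (Gam (g i) c x *m sigma i x + sigma i x *m (Gam (g i) c x)^T)
  - tGam (g i) (- 2%:R / n.+1%:R) c x *: sigma i x.
Proof.
move=> hs Xx; apply/matrixP => a b.
have := hs i x Xx c a b; rewrite /trace_free nabla_sym2E.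
have E : (bas R c *m (sigma_div i x)^T + sigma_div i x *m (bas R c)^T) a b =
   n.+1%:R^-1 * ((c == a)%:R * (\sum_(d < n) nabla_sym2 g sigma i x d d b) +
     (c == b)%:R * (\sum_(d < n) nabla_sym2 g sigma i x d d a)).
  rewrite entD ![(_ *m _) _ _]mxE !big_ord1 !mxE eqxx !andbT.
  by rewrite ![_ == c]eq_sym; ring.
by rewrite -E !(entD, entN, entZ); lra.
Qed.

Hypothesis hnull : on_open_dense (weyl_nullity_at g).
Hypothesis hB : nullity_function g B.
Hypothesis hsigma : metrisability_solution g sigma.

Lemma chart_span i x : X i x -> D i x != 0 -> in_span (g i x) (T i x) (D i x).
Proof.
move=> Xx D0; have oX : open (X i) by exact: open_X.
have Gs y : X i y -> (g i y)^T = g i y by exact: met_sym.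
have Gu y : X i y -> g i y \in unitmx by exact: met_nondegenerate.
have sG : smx (X i) (g i) by move=> ? ?; exact: met_smooth.
have sS : smx (X i) (sigma i) by move=> ? ?; exact: ws2_smooth.
have Ss y : X i y -> (sigma i y)^T = sigma i y by exact: ws2_sym.
have HS y c (Xy : X i y) := metrisability_normal_form c hsigma Xy.
apply: (local_span n2 oX sG Gs Gu sS Ss (smx_sigma_div i) HS (sB i) _ Xx D0).
apply: (Lam_scalar n2 oX sG Gs Gu sS Ss (smx_sigma_div i) HS (sB i)) => V oV VX [y Vy].
have [Q [_ dQ nQ]] := hnull.
(* Density of the nullity points is known on the manifold, so the coordinate set V is pulled back to
   an open set of points. *)
have [|q [[dq Vq] Qq]] := dQ [set q | dom (charts i) q /\ V (coord (charts i) q)] _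
    (open_chart_preimage i oV).
  have [dy _ ey] := in_chartP (VX _ Vy).
  by exists (coord_inv (charts i) y); split=> //=; rewrite ey.
have [v [v0 vN]] := nQ q Qq.
exists (coord (charts i) q), (v i); split=> //; first exact: v0.
by move=> c d; exact: nullity_Zc hB vN dq.
Qed.

Definition gradc i x : 'cV[R]_n := invmx (g i x) *m (D i x)^T.

Lemma gradc_neq0 i x : X i x -> D i x != 0 -> gradc i x != 0.
Proof.
move=> Xx; have Gu : g i x \in unitmx by exact: met_nondegenerate.
apply: contraNneq => h; rewrite -[D i x]trmxK -[(D i x)^T](mulKVmx Gu).
by rewrite -/(gradc i x) h mulmx0 trmx0.
Qed.

Definition nu_sol i x := nu_of (T i x) (D i x).
Definition eps_sol i x := eps_of (T i x) (D i x) (gradc i x).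

Lemma chart_decomposition i x : X i x -> D i x != 0 ->
  T i x = (nu_sol i x)%:M + eps_sol i x *: (gradc i x *m D i x).
Proof.
move=> Xx D0; have [nu [e TE]] := chart_span Xx D0.
rewrite -/(gradc i x) in TE.
have [nuE eE] := coefficients_unique (ltn_trans (ltnSn 1) n2) D0 (gradc_neq0 Xx D0) TE.
by rewrite /nu_sol /eps_sol nuE eE.
Qed.

(** The Euclidean formulas are not covariant by themselves. The decomposition in chart i is
    transported to chart j, and uniqueness identifies its coefficients there. *)
Lemma solution_change i j p : dom (charts i) p -> dom (charts j) p ->
  dfun_nonzero_at B p ->
  let x := coord (charts i) p in let y := coord (charts j) p in
  nu_sol j y = density_factor (- 2%:R) i j x * nu_sol i x /\
  eps_sol j y = density_factor (- 2%:R) i j x * eps_sol i x.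
Proof.
move=> di dj Dp x y; set f := density_factor _ _ _ _.
have ox : overlap i j x by exact: in_chart_coord.
have Xx : X i x by exact: in_chart_coord.
have Xy : X j y by exact: in_chart_coord.
have cxy : change i j x = y by exact: change_coord.
have Dx : D i x != 0 by apply/(dfun_nonzeroP sB di).
have Dy : D j y != 0 by apply/(dfun_nonzeroP sB dj).
pose J := Jac i j x.
have DJ : D i x = D j y *m J by exact: dfun_change.
have gJ : g i x = J^T *m g j y *m J by rewrite -cxy; exact: met_change.
have sJ : sigma j y = f *: (J *m sigma i x *m J^T) by rewrite -cxy; exact: ws2_change.
have gu : g i x \in unitmx by exact: met_nondegenerate.
have gv : g j y \in unitmx by exact: met_nondegenerate.
have Ju : J \in unitmx by move: gu; rewrite gJ unitmx_mul => /andP[].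
have JTu : J^T \in unitmx by rewrite unitmx_tr.
have VJ : J *m gradc i x = gradc j y.
  apply: (can_inj (mulKmx gv)); apply: (can_inj (mulKmx JTu)).
  by rewrite /gradc mulKVmx // -trmx_mul -DJ !mulmxA -gJ mulmxV // mul1mx.
have TJ : T j y *m J = f *: (J *m T i x).
  by rewrite sJ gJ -!scalemxAl !mulmxA.
have TE : T j y = (f * nu_sol i x)%:M + (f * eps_sol i x) *: (gradc j y *m D j y).
  apply: (can_inj (mulmxK Ju)); rewrite TJ chart_decomposition // mulmxDl mulmxDr.
  rewrite mul_mx_scalar mul_scalar_mx -scalemxAr -scalemxAl mulmxA VJ -[in RHS]mulmxA -DJ.
  by rewrite scalerDr !scalerA.
exact: coefficients_unique (ltn_trans (ltnSn 1) n2) Dy (gradc_neq0 Xy Dy) TE.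
Qed.

(** The neighbourhood is the whole open set where dB is nonzero, since the coefficients come from
    formulas and not from choices. *)
Lemma locally_decomposed p : dfun_nonzero_at B p ->
  locally_nu_delta_eps_BB g B sigma p.
Proof.
move=> Dp; pose U := [set q | dfun_nonzero_at B q].
have oU : open U by exact: open_dfun_nonzero.
have oUi i : open (in_chart i U) by exact: open_in_chart.
have XU i : in_chart i U `<=` X i by exact: in_chart_sub.
have DU i x : in_chart i U x -> D i x != 0.
  by move=> Ux; have [dx Dx ex] := in_chartP Ux; rewrite -ex; apply/(dfun_nonzeroP sB dx).
have VU i x : in_chart i U x -> gradc i x != 0.
  by move=> Ux; apply: gradc_neq0; [exact: XU Ux|exact: DU].
have sub i r k (F : 'rV[R]_n -> 'M[R]_(r, k)) : smx (X i) F -> smx (in_chart i U) F.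
  by move=> sF a b; exact: smooth_subset (XU i) (sF a b).
have sG i : smx (in_chart i U) (g i) by apply: sub => ? ?; exact: met_smooth.
have sS i : smx (in_chart i U) (sigma i) by apply: sub => ? ?; exact: ws2_smooth.
have sD i : smx (in_chart i U) (drow B i) by apply: sub; exact: smx_drow.
have sT i : smx (in_chart i U) (fun x => T i x) by apply: smx_mul.
have sV i : smx (in_chart i U) (gradc i).
  apply: smx_mul => //; last exact: smx_tr.
  by apply: smx_inv => // x /XU Xx; exact: met_nondegenerate.
have cnu i j x : in_chart i (dom (charts j) `&` U) x ->
    nu_sol j (change i j x) = density_factor (- 2%:R) i j x * nu_sol i x.
  by move=> [q [di [dj Dq]] <-]; rewrite change_coord //; have [] := solution_change di dj Dq.
have ceps i j x : in_chart i (dom (charts j) `&` U) x ->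
    eps_sol j (change i j x) = density_factor (- 2%:R) i j x * eps_sol i x.
  by move=> [q [di [dj Dq]] <-]; rewrite change_coord //; have [] := solution_change di dj Dq.
have snu i : smooth_on (in_chart i U) (nu_sol i).
  by apply: smooth_nu_of => //; exact: DU.
have seps i : smooth_on (in_chart i U) (eps_sol i).
  by apply: smooth_eps_of => //; [exact: DU|exact: VU].
exists U; split=> //; exists (Density snu cnu), (Density seps ceps).
move=> i x Ux a b /=.
have -> : lower_snd g sigma i x a b = T i x a b.
  rewrite mxE; apply: eq_bigr => c _; rewrite mulrC; congr (_ * _).
  by rewrite -[in LHS](met_sym g (XU _ _ Ux)) mxE.
rewrite (chart_decomposition (XU _ _ Ux) (DU _ _ Ux)) entD entZ; congr (_ + _ * _).
  by rewrite mxE mulr_natr.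
rewrite mxE big_ord1 [D i x _ _]mxE; congr (_ * _).
by rewrite mxE; apply: eq_bigr => c _; rewrite !mxE.
Qed.

End Solutions.

Theorem theorem4p25 (R : realType) (n : nat) (hn : (2 < n)%N)
  (M : manifold R n) (m : set (metric M)) (hm : metric_projective_structure m)
  (g : metric M) (hg : m g) (hnull : on_open_dense (weyl_nullity_at g))
  (B : M -> R) (hBsmooth : smooth_function B) (hB : nullity_function g B)
  (hBnc : on_open_dense (nonconstant_at B))
  (sigma : weighted_sym2 M (- 2%:R)%R)
  (hsigma : metrisability_solution g sigma) :
  on_open_dense (locally_nu_delta_eps_BB g B sigma) /\
  (forall p : M, dfun_nonzero_at B p -> locally_nu_delta_eps_BB g B sigma p).
Proof.
have H p := @locally_decomposed R n M g hn B hBsmooth sigma hnull hB hsigma p.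
split=> //; exists [set p | dfun_nonzero_at B p]; split=> //.
- exact: open_dfun_nonzero.
- exact: dense_dfun_nonzero.
Qed.
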